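(* Let $(D,y)$ be a left Kan pseudomonad on a 2-category $\mathcal K$, with Kleisli 2-category $\mathcal K_D$, canonical pseudofunctor $J_D:\mathcal K\to\mathcal K_D$, and forgetful 2-functor $U^D:\text{Ps-}D\text{-Alg}\to\mathcal K$. The free-forgetful biadjunction between $\mathcal K$ and $\text{Ps-}D\text{-Alg}$ induces a colax adjunction between the Kleisli 2-category and the 2-category of algebras, in which the inclusion $\mathcal K_D\hookrightarrow\text{Ps-}D\text{-Alg}$ is left colax adjoint to $J_D\circ U^D:\text{Ps-}D\text{-Alg}\to\mathcal K_D$.
   Context: Left Kan pseudomonads. A left Kan pseudomonad $(D,y)$ on a 2-category $\mathcal K$ (equivalently, a lax-idempotent pseudomonad) consists of: a function $D$ on objects of $\mathcal K$; 1-cells $y_A:A\to DA$; and for each 1-cell $f:A\to DB$ a 1-cell $f^{\mathbb D}:DA\to DB$ and an invertible 2-cell $\mathbb D_f:f\Rightarrow f^{\mathbb D}y_A$ exhibiting $f^{\mathbb D}$ as a left Kan extension of $f$ along $y_A$; such that (i) the identity 2-cell on $y_A$ exhibits $1_{DA}$ as a left Kan extension of $y_A$ along $y_A$; (ii) for all $g:B\to DC$ and $f:A\to DB$, $g^{\mathbb D}$ preserves the left Kan extension $(f^{\mathbb D},\mathbb D_f)$. A pseudo-$D$-algebra is an object $C$ with, for each $f:B\to C$, a 1-cell $f^{\mathbb C}:DB\to C$ and an invertible 2-cell $\mathbb C_f:f\Rightarrow f^{\mathbb C}y_B$ exhibiting $f^{\mathbb C}$ as a left Kan extension of $f$ along $y_B$,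 such that for all $g:B\to C$ and $f:A\to DB$, $g^{\mathbb C}$ preserves $(f^{\mathbb D},\mathbb D_f)$. A $D$-pseudomorphism $h:C\to X$ is a 1-cell preserving the left Kan extensions $(f^{\mathbb C},\mathbb C_f)$. These, with all 2-cells of $\mathcal K$ between pseudomorphisms, form the 2-category $\text{Ps-}D\text{-Alg}$. The Kleisli 2-category $\mathcal K_D$ is its full sub-2-category on the free algebras $(DA,(-)^{\mathbb D})$. The pseudofunctor $J_D:\mathcal K\to\mathcal K_D$ sends $A\mapsto DA$ and $f:A\to B$ to $(y_Bf)^{\mathbb D}$. The forgetful 2-functor $U^D$ has a left biadjoint $F^D$, $A\mapsto (DA,(-)^{\mathbb D})$, namely $J_D$ followed by the inclusion. Colax adjunctions. For a pseudofunctor $K$ the structure isomorphisms are $\gamma:K(gf)\Rightarrow Kg\circ Kf$ and $\iota:K1_A\Rightarrow 1_{KA}$. A colax natural transformation $\alpha:K\Rightarrow K'$ consists of 1-cells $\alpha_A:KA\to K'A$ and 2-cells $\alpha_f:\alpha_B\circ Kf\Rightarrow K'f\circ\alpha_A$ for $f:A\to B$, subject to the usual unit, composition and local naturality axioms. A colax adjunction exhibiting $F:\mathcal X\to\mathcal Y$ as left colax adjoint to $U:\mathcal Y\to\mathcal X$ consists of pseudofunctors $F,U$, colax natural transformations $\eta:1_{\mathcal X}\Rightarrow UF$, $\epsilon:FU\Rightarrow 1_{\mathcal Y}$ and modifications $\Psi:\epsilon F\circ F\eta\to 1_F$, $\Phi:1_U\to U\epsilon\circ\eta U$ such that for all $A\in\mathcal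 X$, $B\in\mathcal Y$ the following composites are identities: $$\eta_A\xrightarrow{\Phi_{FA}\eta_A}U\epsilon_{FA}\,\eta_{UFA}\,\eta_A\xrightarrow{U\epsilon_{FA}\,\eta_{\eta_A}}U\epsilon_{FA}\,UF\eta_A\,\eta_A\xrightarrow{(U\Psi)_A\eta_A}\eta_A,$$ $$\epsilon_B\xrightarrow{\epsilon_B(F\Phi)_B}\epsilon_B\,FU\epsilon_B\,F\eta_{UB}\xrightarrow{\epsilon_{\epsilon_B}F\eta_{UB}}\epsilon_B\,\epsilon_{FUB}\,F\eta_{UB}\xrightarrow{\epsilon_B\Psi_{UB}}\epsilon_B,$$ where $(U\Psi)_A=\iota\circ U\Psi_A\circ\gamma^{-1}$ and $(F\Phi)_B=\gamma\circ F\Phi_B\circ\iota^{-1}$. A biadjunction is a colax adjunction in which $\eta,\epsilon$ are pseudonatural (2-cell components invertible) and $\Psi,\Phi$ are invertible. *)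

(* Defs.v *)
From Corelib Require Import ssreflect.
From Stdlib Require Import ProofIrrelevance IndefiniteDescription.

Set Implicit Arguments.
Unset Strict Implicit.
Unset Printing Implicit Defensive.
Set Primitive Projections.

Declare Scope twocat_scope.
Open Scope twocat_scope.

(** * Strict 2-categories *)

Record TwoCatData := {
  ob :> Type;
  hom : ob -> ob -> Type;
  cell : forall A B : ob, hom A B -> hom A B -> Type;
  id1 : forall A, hom A A;
  comp1 : forall A B C, hom B C -> hom A B -> hom A C;
  id2 : forall A B (f : hom A B), cell f f;
  vcomp : forall A B (f g h : hom A B), cell g h -> cell f g -> cell f h;
  hcomp : forall A B C (g g' : hom B C) (f f' : hom A B),
    cell g g' -> cell f f' -> cell (comp1 g f) (comp1 g' f')
}.
Arguments hom {t} A B.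
Arguments cell {t A B} f g.
Arguments id1 {t} A.
Arguments comp1 {t A B C} g f.
Arguments id2 {t A B} f.
Arguments vcomp {t A B f g h} b a.
Arguments hcomp {t A B C g g' f f'} b a.

Notation "g ∘ f" := (comp1 g f) (at level 40, left associativity) : twocat_scope.
Notation "f ⇒ g" := (cell f g) (at level 70, no associativity) : twocat_scope.
Notation "b • a" := (vcomp b a) (at level 50, left associativity) : twocat_scope.
Notation "b ⋆ a" := (hcomp b a) (at level 39, left associativity) : twocat_scope.
Notation "g ◁ a" := (hcomp (id2 g) a) (at level 39, left associativity) : twocat_scope.
Notation "b ▷ f" := (hcomp b (id2 f)) (at level 39, left associativity) : twocat_scope.

(** The identity 2-cell between 1-cells that are equal, but not convertible. *)
Definition eqcell (K : TwoCatData) (A B : K) (f g : hom A B) (e : f = g) : f ⇒ g :=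
  match e in _ = g' return f ⇒ g' with eq_refl => id2 f end.

(** The axioms of a category enriched over [Cat]: each [hom A B] is a category, [hcomp]
    is a functor, and composition is strictly associative and unital. *)
Record TwoCatLaws (K : TwoCatData) : Prop := {
  vcompA_ : forall (A B : K) (f g h k : hom A B) (c : h ⇒ k) (b : g ⇒ h) (a : f ⇒ g),
    c • (b • a) = (c • b) • a;
  vcomp1l_ : forall (A B : K) (f g : hom A B) (a : f ⇒ g), id2 g • a = a;
  vcomp1r_ : forall (A B : K) (f g : hom A B) (a : f ⇒ g), a • id2 f = a;
  hcomp_id_ : forall (A B C : K) (g : hom B C) (f : hom A B),
    id2 g ⋆ id2 f = id2 (g ∘ f);
  hcomp_vcomp_ : forall (A B C : K) (g g' g'' : hom B C) (f f' f'' : hom A B)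
      (b' : g' ⇒ g'') (b : g ⇒ g') (a' : f' ⇒ f'') (a : f ⇒ f'),
    (b' • b) ⋆ (a' • a) = (b' ⋆ a') • (b ⋆ a);
  comp1A_ : forall (A B C E : K) (h : hom C E) (g : hom B C) (f : hom A B),
    h ∘ (g ∘ f) = (h ∘ g) ∘ f;
  comp1l_ : forall (A B : K) (f : hom A B), id1 B ∘ f = f;
  comp1r_ : forall (A B : K) (f : hom A B), f ∘ id1 A = f;
  hcompA_ : forall (A B C E : K) (h h' : hom C E) (g g' : hom B C) (f f' : hom A B)
      (c : h ⇒ h') (b : g ⇒ g') (a : f ⇒ f'),
    eqcell (comp1A_ h' g' f') • (c ⋆ (b ⋆ a)) = ((c ⋆ b) ⋆ a) • eqcell (comp1A_ h g f);
  hcomp1l_ : forall (A B : K) (f f' : hom A B) (a : f ⇒ f'),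
    eqcell (comp1l_ f') • (id2 (id1 B) ⋆ a) = a • eqcell (comp1l_ f);
  hcomp1r_ : forall (A B : K) (f f' : hom A B) (a : f ⇒ f'),
    eqcell (comp1r_ f') • (a ⋆ id2 (id1 A)) = a • eqcell (comp1r_ f)
}.

Record TwoCat := { tc_data :> TwoCatData; tc_laws : TwoCatLaws tc_data }.

Section TwoCatTheory.
Variable K : TwoCat.

Lemma vcompA (A B : K) (f g h k : hom A B) (c : h ⇒ k) (b : g ⇒ h) (a : f ⇒ g) :
  c • (b • a) = (c • b) • a.
Proof. exact: (vcompA_ (tc_laws K)). Qed.
Lemma vcomp1l (A B : K) (f g : hom A B) (a : f ⇒ g) : id2 g • a = a.
Proof. exact: (vcomp1l_ (tc_laws K)). Qed.
Lemma vcomp1r (A B : K) (f g : hom A B) (a : f ⇒ g) : a • id2 f = a.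
Proof. exact: (vcomp1r_ (tc_laws K)). Qed.
Lemma hcomp_id (A B C : K) (g : hom B C) (f : hom A B) : id2 g ⋆ id2 f = id2 (g ∘ f).
Proof. exact: (hcomp_id_ (tc_laws K)). Qed.
Lemma hcomp_vcomp (A B C : K) (g g' g'' : hom B C) (f f' f'' : hom A B)
      (b' : g' ⇒ g'') (b : g ⇒ g') (a' : f' ⇒ f'') (a : f ⇒ f') :
  (b' • b) ⋆ (a' • a) = (b' ⋆ a') • (b ⋆ a).
Proof. exact: (hcomp_vcomp_ (tc_laws K)). Qed.
Lemma comp1A (A B C E : K) (h : hom C E) (g : hom B C) (f : hom A B) :
  h ∘ (g ∘ f) = (h ∘ g) ∘ f.
Proof. exact: (comp1A_ (tc_laws K)). Qed.
Lemma comp1l (A B : K) (f : hom A B) : id1 B ∘ f = f.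
Proof. exact: (comp1l_ (tc_laws K)). Qed.
Lemma comp1r (A B : K) (f : hom A B) : f ∘ id1 A = f.
Proof. exact: (comp1r_ (tc_laws K)). Qed.

Definition asc (A B C E : K) (h : hom C E) (g : hom B C) (f : hom A B) :
  h ∘ (g ∘ f) ⇒ (h ∘ g) ∘ f := eqcell (comp1A h g f).
Definition asci (A B C E : K) (h : hom C E) (g : hom B C) (f : hom A B) :
  (h ∘ g) ∘ f ⇒ h ∘ (g ∘ f) := eqcell (eq_sym (comp1A h g f)).
Definition lun (A B : K) (f : hom A B) : id1 B ∘ f ⇒ f := eqcell (comp1l f).
Definition luni (A B : K) (f : hom A B) : f ⇒ id1 B ∘ f := eqcell (eq_sym (comp1l f)).
Definition run (A B : K) (f : hom A B) : f ∘ id1 A ⇒ f := eqcell (comp1r f).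
Definition runi (A B : K) (f : hom A B) : f ⇒ f ∘ id1 A := eqcell (eq_sym (comp1r f)).

(** By proof irrelevance any two parallel coherence cells are equal; the tactic [nf] below
    moves them towards each other, so that coherence is decided by rewriting. *)
Lemma eqcell_irr (A B : K) (f g : hom A B) (e e' : f = g) : eqcell e = eqcell e'.
Proof. by rewrite (proof_irrelevance _ e e'). Qed.
Lemma eqcell1 (A B : K) (f : hom A B) (e : f = f) : eqcell e = id2 f.
Proof. exact: (eqcell_irr e eq_refl). Qed.
Lemma eqcellM (A B : K) (f g h : hom A B) (e' : g = h) (e : f = g) :
  eqcell e' • eqcell e = eqcell (eq_trans e e').
Proof. by case: h / e' => /=; rewrite vcomp1l. Qed.
Lemma eqcellMA (A B : K) (f g h k : hom A B) (a : k ⇒ f) (e' : g = h) (e : f = g) :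
  eqcell e' • (eqcell e • a) = eqcell (eq_trans e e') • a.
Proof. by rewrite vcompA eqcellM. Qed.
Lemma lwM (A B C : K) (g : hom B C) (f f' f'' : hom A B) (a' : f' ⇒ f'') (a : f ⇒ f') :
  g ◁ (a' • a) = g ◁ a' • g ◁ a.
Proof. by rewrite -hcomp_vcomp vcomp1l. Qed.
Lemma rwM (A B C : K) (g g' g'' : hom B C) (f : hom A B) (b' : g' ⇒ g'') (b : g ⇒ g') :
  (b' • b) ▷ f = b' ▷ f • b ▷ f.
Proof. by rewrite -hcomp_vcomp vcomp1l. Qed.
Lemma lwE (A B C : K) (g : hom B C) (f f' : hom A B) (e : f = f') :
  g ◁ eqcell e = eqcell (f_equal (comp1 g) e).
Proof. by case: f' / e => /=; rewrite hcomp_id. Qed.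
Lemma rwE (A B C : K) (g g' : hom B C) (f : hom A B) (e : g = g') :
  eqcell e ▷ f = eqcell (f_equal (fun k => comp1 k f) e).
Proof. by case: g' / e => /=; rewrite hcomp_id. Qed.
Lemma hcompE (A B C : K) (g g' : hom B C) (f f' : hom A B) (b : g ⇒ g') (a : f ⇒ f') :
  b ⋆ a = b ▷ f' • g ◁ a.
Proof. by rewrite -hcomp_vcomp vcomp1l vcomp1r. Qed.
Lemma hcompE' (A B C : K) (g g' : hom B C) (f f' : hom A B) (b : g ⇒ g') (a : f ⇒ f') :
  b ⋆ a = g' ◁ a • b ▷ f.
Proof. by rewrite -hcomp_vcomp vcomp1l vcomp1r. Qed.
Lemma interchange (A B C : K) (g g' : hom B C) (f f' : hom A B) (b : g ⇒ g') (a : f ⇒ f') :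
  b ▷ f' • g ◁ a = g' ◁ a • b ▷ f.
Proof. by rewrite -hcompE hcompE'. Qed.

Lemma eqcell_movel (A B : K) (f g h : hom A B) (e : g = h) (b : f ⇒ g) (a : f ⇒ h) :
  eqcell e • b = a -> b = eqcell (eq_sym e) • a.
Proof. by move=> <-; rewrite eqcellMA eqcell1 vcomp1l. Qed.

Lemma rw_rw (A B C E : K) (h h' : hom C E) (g : hom B C) (f : hom A B) (c : h ⇒ h') :
  (c ▷ g) ▷ f = asc h' g f • (c ▷ (g ∘ f) • asci h g f).
Proof.
have := hcompA_ (tc_laws K) c (id2 g) (id2 f); rewrite hcomp_id /asc /asci.
rewrite vcompA (eqcell_irr _ (comp1A h' g f)) => ->.
by rewrite -vcompA eqcellM eqcell1 vcomp1r.
Qed.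
Lemma rw_lw (A B C E : K) (h : hom C E) (g g' : hom B C) (f : hom A B) (b : g ⇒ g') :
  (h ◁ b) ▷ f = asc h g' f • (h ◁ (b ▷ f) • asci h g f).
Proof.
have := hcompA_ (tc_laws K) (id2 h) b (id2 f); rewrite /asc /asci.
rewrite vcompA (eqcell_irr _ (comp1A h g' f)) => ->.
by rewrite -vcompA eqcellM eqcell1 vcomp1r.
Qed.
Lemma lw_comp (A B C E : K) (h : hom C E) (g : hom B C) (f f' : hom A B) (a : f ⇒ f') :
  (h ∘ g) ◁ a = asc h g f' • (h ◁ (g ◁ a) • asci h g f).
Proof.
have := hcompA_ (tc_laws K) (id2 h) (id2 g) a; rewrite hcomp_id /asc /asci.
rewrite vcompA (eqcell_irr _ (comp1A h g f')) => ->.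
by rewrite -vcompA eqcellM eqcell1 vcomp1r.
Qed.
Lemma lw_id (A B : K) (f f' : hom A B) (a : f ⇒ f') :
  id1 B ◁ a = luni f' • (a • lun f).
Proof.
rewrite /luni /lun; have := hcomp1l_ (tc_laws K) a.
by move=> /eqcell_movel ->; congr vcomp; [exact: eqcell_irr | congr vcomp; exact: eqcell_irr].
Qed.
Lemma rw_id (A B : K) (f f' : hom A B) (a : f ⇒ f') :
  a ▷ id1 A = runi f' • (a • run f).
Proof.
rewrite /runi /run; have := hcomp1r_ (tc_laws K) a.
by move=> /eqcell_movel ->; congr vcomp; [exact: eqcell_irr | congr vcomp; exact: eqcell_irr].
Qed.

End TwoCatTheory.

Ltac unf := rewrite /asc /asci /lun /luni /run /runi.

Ltac fin := repeat first [ reflexivity | exact: eqcell_irr | congr (_ • _) ].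

Ltac nf := unf; repeat first
  [ progress rewrite -> ?lwM, ?rwM, ?hcomp_id, ?vcomp1l, ?vcomp1r
  | progress rewrite -> ?rw_rw, ?rw_lw, ?lw_comp, ?lw_id, ?rw_id; unf
  | progress rewrite -> ?lwE, ?rwE
  | progress rewrite <- ?vcompA
  | progress rewrite -> ?eqcellMA, ?eqcellM, ?eqcell1 ].

Definition is_iso (K : TwoCat) (A B : K) (f g : hom A B) (a : f ⇒ g) : Prop :=
  exists b : g ⇒ f, b • a = id2 f /\ a • b = id2 g.

(** * Pseudofunctors *)

Record PFMap (X Y : TwoCat) := {
  pf0 :> X -> Y;
  pf1 : forall A B : X, hom A B -> hom (pf0 A) (pf0 B)
}.
Arguments pf1 {X Y} F {A B} f : rename.

Record PFData (X Y : TwoCat) := {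
  pf_map :> PFMap X Y;
  pf2 : forall (A B : X) (f g : hom A B), f ⇒ g -> pf1 pf_map f ⇒ pf1 pf_map g;
  gam : forall (A B C : X) (g : hom B C) (f : hom A B),
    pf1 pf_map (g ∘ f) ⇒ pf1 pf_map g ∘ pf1 pf_map f;
  gami : forall (A B C : X) (g : hom B C) (f : hom A B),
    pf1 pf_map g ∘ pf1 pf_map f ⇒ pf1 pf_map (g ∘ f);
  iot : forall A : X, pf1 pf_map (id1 A) ⇒ id1 (pf_map A);
  ioti : forall A : X, id1 (pf_map A) ⇒ pf1 pf_map (id1 A)
}.
Arguments pf2 {X Y} F {A B f g} a : rename.
Arguments gam {X Y} F {A B C} g f : rename.
Arguments gami {X Y} F {A B C} g f : rename.
Arguments iot {X Y} F A : rename.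
Arguments ioti {X Y} F A : rename.

Record PFLaws (X Y : TwoCat) (F : PFData X Y) : Prop := {
  pf2_id : forall (A B : X) (f : hom A B), pf2 F (id2 f) = id2 (pf1 F f);
  pf2_comp : forall (A B : X) (f g h : hom A B) (b : g ⇒ h) (a : f ⇒ g),
    pf2 F (b • a) = pf2 F b • pf2 F a;
  gamK : forall (A B C : X) (g : hom B C) (f : hom A B), gami F g f • gam F g f = id2 _;
  gamiK : forall (A B C : X) (g : hom B C) (f : hom A B), gam F g f • gami F g f = id2 _;
  iotK : forall A : X, ioti F A • iot F A = id2 _;
  iotiK : forall A : X, iot F A • ioti F A = id2 _;
  gam_nat : forall (A B C : X) (g g' : hom B C) (f f' : hom A B) (b : g ⇒ g') (a : f ⇒ f'),
    gam F g' f' • pf2 F (b ⋆ a) = (pf2 F b ⋆ pf2 F a) • gam F g f;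
  gam_assoc : forall (A B C E : X) (h : hom C E) (g : hom B C) (f : hom A B),
    asc (pf1 F h) (pf1 F g) (pf1 F f) • (pf1 F h ◁ gam F g f) • gam F h (g ∘ f)
    = (gam F h g ▷ pf1 F f) • gam F (h ∘ g) f • pf2 F (asc h g f);
  gam_idl : forall (A B : X) (f : hom A B),
    lun (pf1 F f) • (iot F B ▷ pf1 F f) • gam F (id1 B) f = pf2 F (lun f);
  gam_idr : forall (A B : X) (f : hom A B),
    run (pf1 F f) • (pf1 F f ◁ iot F A) • gam F f (id1 A) = pf2 F (run f)
}.

Record Pseudofunctor (X Y : TwoCat) := {
  pf_data :> PFData X Y;
  pf_laws : PFLaws pf_data
}.

Definition map_id (X : TwoCat) : PFMap X X :=
  {| pf0 := fun A => A; pf1 := fun A B f => f |}.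

Definition map_comp (X Y Z : TwoCat) (G : PFMap Y Z) (F : PFMap X Y) : PFMap X Z :=
  {| pf0 := fun A => G (F A); pf1 := fun A B f => pf1 G (pf1 F f) |}.

Definition pf_id_data (X : TwoCat) : PFData X X := {|
  pf_map := map_id X;
  pf2 := fun A B f g a => a;
  gam := fun A B C g f => id2 (g ∘ f);
  gami := fun A B C g f => id2 (g ∘ f);
  iot := fun A => id2 (id1 A);
  ioti := fun A => id2 (id1 A)
|}.

Definition pf_comp_data (X Y Z : TwoCat) (G : PFData Y Z) (F : PFData X Y) : PFData X Z := {|
  pf_map := map_comp G F;
  pf2 := fun A B f g a => pf2 G (pf2 F a);
  gam := fun A B C g f => gam G (pf1 F g) (pf1 F f) • pf2 G (gam F g f);
  gami := fun A B C g f => pf2 G (gami F g f) • gami G (pf1 F g) (pf1 F f);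
  iot := fun A => iot G (F A) • pf2 G (iot F A);
  ioti := fun A => pf2 G (ioti F A) • ioti G (F A)
|}.

Lemma pf_id_laws (X : TwoCat) : PFLaws (pf_id_data X).
Proof.
split=> //= *; rewrite ?hcomp_id ?vcomp1l ?vcomp1r //.
Qed.

Lemma pf2_eqcell (X Y : TwoCat) (F : PFData X Y) (HF : PFLaws F) (A B : X)
    (f g : hom A B) (e : f = g) :
  pf2 F (eqcell e) = eqcell (f_equal (@pf1 _ _ F A B) e).
Proof. by case: g / e => /=; rewrite (pf2_id HF). Qed.

Lemma pf_comp_laws (X Y Z : TwoCat) (G : PFData Y Z) (F : PFData X Y) :
  PFLaws G -> PFLaws F -> PFLaws (pf_comp_data G F).
Proof.
move=> HG HF; split=> /=.
- by move=> *; rewrite (pf2_id HF) (pf2_id HG).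
- by move=> *; rewrite (pf2_comp HF) (pf2_comp HG).
- move=> *; rewrite -vcompA (vcompA _ (gam G _ _)) (gamK HG) vcomp1l.
  by rewrite -(pf2_comp HG) (gamK HF) (pf2_id HG).
- move=> *; rewrite -vcompA (vcompA (pf2 G _) (pf2 G _)) -(pf2_comp HG) (gamiK HF) (pf2_id HG).
  by rewrite vcomp1l (gamiK HG).
- move=> *; rewrite -vcompA (vcompA _ (iot G _)) (iotK HG) vcomp1l.
  by rewrite -(pf2_comp HG) (iotK HF) (pf2_id HG).
- move=> *; rewrite -vcompA (vcompA (pf2 G _) (pf2 G _)) -(pf2_comp HG) (iotiK HF) (pf2_id HG).
  by rewrite vcomp1l (iotiK HG).
- move=> *; rewrite -vcompA -(pf2_comp HG) (gam_nat HF) (pf2_comp HG) vcompA.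
  by rewrite (gam_nat HG) vcompA.
- move=> A B C E h g f; rewrite lwM rwM.
  have n1 := gam_nat HG (id2 (pf1 F h)) (gam F g f); rewrite (pf2_id HG) in n1.
  have n1' := gam_nat HG (gam F h g) (id2 (pf1 F f)); rewrite (pf2_id HG) in n1'.
  rewrite -!vcompA (vcompA (_ ◁ _) (gam G _ _)) -n1 -!vcompA.
  rewrite 2!vcompA (gam_assoc HG) -!vcompA -!(pf2_comp HG).
    have := gam_assoc HF h g f; rewrite -!vcompA => ->.
  by rewrite (pf2_comp HG) (vcompA (gam G _ _)) n1' -!vcompA.
- move=> A B f; rewrite rwM.
  have n1 := gam_nat HG (iot F B) (id2 (pf1 F f)); rewrite (pf2_id HG) in n1.
  rewrite -!vcompA (vcompA _ (gam G _ _)) -n1.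
  rewrite -vcompA -(pf2_comp HG) 2!vcompA (gam_idl HG) -(pf2_comp HG).
  by rewrite vcompA (gam_idl HF).
- move=> A B f; rewrite lwM.
  have n1 := gam_nat HG (id2 (pf1 F f)) (iot F A); rewrite (pf2_id HG) in n1.
  rewrite -!vcompA (vcompA _ (gam G _ _)) -n1.
  rewrite -vcompA -(pf2_comp HG) 2!vcompA (gam_idr HG) -(pf2_comp HG).
  by rewrite vcompA (gam_idr HF).
Qed.

Definition pf_id (X : TwoCat) : Pseudofunctor X X :=
  {| pf_data := pf_id_data X; pf_laws := pf_id_laws X |}.

Definition pf_comp (X Y Z : TwoCat) (G : Pseudofunctor Y Z) (F : Pseudofunctor X Y) :
    Pseudofunctor X Z :=
  {| pf_data := pf_comp_data G F; pf_laws := pf_comp_laws (pf_laws G) (pf_laws F) |}.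

(** * Colax natural transformations *)

(** The components only mention the action on objects and 1-cells, so that transformations
    between differently bracketed composites of pseudofunctors have the same type of
    components. *)
Record ColaxData (X Y : TwoCat) (F G : PFMap X Y) := {
  ct1 : forall A : X, hom (F A) (G A);
  ct2 : forall (A B : X) (f : hom A B), ct1 B ∘ pf1 F f ⇒ pf1 G f ∘ ct1 A
}.
Arguments Build_ColaxData {X Y} F G ct1 ct2.
Arguments ct1 {X Y F G} a A : rename.
Arguments ct2 {X Y F G} a {A B} f : rename.

Record ColaxLaws (X Y : TwoCat) (F G : PFData X Y) (a : ColaxData F G) : Prop := {
  ct_nat : forall (A B : X) (f g : hom A B) (s : f ⇒ g),
    (pf2 G s ▷ ct1 a A) • ct2 a f = ct2 a g • (ct1 a B ◁ pf2 F s);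
  ct_unit : forall A : X,
    (iot G A ▷ ct1 a A) • ct2 a (id1 A)
    = luni (ct1 a A) • run (ct1 a A) • (ct1 a A ◁ iot F A);
  ct_comp : forall (A B C : X) (g : hom B C) (f : hom A B),
    (gam G g f ▷ ct1 a A) • ct2 a (g ∘ f)
    = asc (pf1 G g) (pf1 G f) (ct1 a A)
      • (pf1 G g ◁ ct2 a f)
      • asci (pf1 G g) (ct1 a B) (pf1 F f)
      • (ct2 a g ▷ pf1 F f)
      • asc (ct1 a C) (pf1 F g) (pf1 F f)
      • (ct1 a C ◁ gam F g f)
}.

Arguments ColaxLaws {X Y} F G a.

Record ColaxTrans (X Y : TwoCat) (F G : Pseudofunctor X Y) := {
  ct_data :> ColaxData F G;
  ct_laws : ColaxLaws F G ct_data
}.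

Definition is_pseudonatural (X Y : TwoCat) (F G : Pseudofunctor X Y)
    (a : ColaxTrans F G) : Prop :=
  forall (A B : X) (f : hom A B), is_iso (ct2 a f).

Definition cd_id (X Y : TwoCat) (F : PFMap X Y) : ColaxData F F := {|
  ct1 := fun A => id1 (F A);
  ct2 := fun A B f => runi (pf1 F f) • lun (pf1 F f)
|}.

Definition cd_comp (X Y : TwoCat) (F G H : PFMap X Y)
    (b : ColaxData G H) (a : ColaxData F G) : ColaxData F H := {|
  ct1 := fun A => ct1 b A ∘ ct1 a A;
  ct2 := fun A B f =>
    asci (pf1 H f) (ct1 b A) (ct1 a A)
    • (ct2 b f ▷ ct1 a A)
    • asc (ct1 b B) (pf1 G f) (ct1 a A)
    • (ct1 b B ◁ ct2 a f)
    • asci (ct1 b B) (ct1 a B) (pf1 F f)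
|}.

(** [a H], for a pseudofunctor [H]. *)
Definition cd_pre (W X Y : TwoCat) (F G : PFMap X Y) (a : ColaxData F G) (H : PFMap W X) :
    ColaxData (map_comp F H) (map_comp G H) :=
  Build_ColaxData (map_comp F H) (map_comp G H)
    (fun A => ct1 a (H A)) (fun A B f => ct2 a (pf1 H f)).

(** [H a], for a pseudofunctor [H]. *)
Definition cd_post (X Y Z : TwoCat) (H : PFData Y Z) (F G : PFMap X Y) (a : ColaxData F G) :
    ColaxData (map_comp H F) (map_comp H G) :=
  Build_ColaxData (map_comp H F) (map_comp H G)
    (fun A => pf1 H (ct1 a A))
    (fun A B f => gam H (pf1 G f) (ct1 a A) • pf2 H (ct2 a f) • gami H (ct1 a B) (pf1 F f)).

Record Modification (X Y : TwoCat) (F G : PFMap X Y) (a b : ColaxData F G) := {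
  mo :> forall A : X, ct1 a A ⇒ ct1 b A;
  mo_nat : forall (A B : X) (f : hom A B),
    ct2 b f • (mo B ▷ pf1 F f) = (pf1 G f ◁ mo A) • ct2 a f
}.

(** * Colax adjunctions *)

Record ColaxAdjunction (X Y : TwoCat) (F : Pseudofunctor X Y) (U : Pseudofunctor Y X) := {
  adj_unit : ColaxTrans (pf_id X) (pf_comp U F);
  adj_counit : ColaxTrans (pf_comp F U) (pf_id Y);
  adj_Psi : Modification (cd_comp (cd_pre adj_counit F) (cd_post F adj_unit)) (cd_id F);
  adj_Phi : Modification (cd_id U) (cd_comp (cd_post U adj_counit) (cd_pre adj_unit U));
  adj_triangle_unit : forall A : X,
    lun (ct1 adj_unit A)
    • ((iot U (F A) • pf2 U (adj_Psi A)
        • gami U (ct1 adj_counit (F A)) (pf1 F (ct1 adj_unit A))) ▷ ct1 adj_unit A)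
    • asc (pf1 U (ct1 adj_counit (F A))) (pf1 U (pf1 F (ct1 adj_unit A))) (ct1 adj_unit A)
    • (pf1 U (ct1 adj_counit (F A)) ◁ ct2 adj_unit (ct1 adj_unit A))
    • asci (pf1 U (ct1 adj_counit (F A))) (ct1 adj_unit (U (F A))) (ct1 adj_unit A)
    • (adj_Phi (F A) ▷ ct1 adj_unit A)
    • luni (ct1 adj_unit A)
    = id2 (ct1 adj_unit A);
  adj_triangle_counit : forall B : Y,
    run (ct1 adj_counit B)
    • (ct1 adj_counit B ◁ adj_Psi (U B))
    • asci (ct1 adj_counit B) (ct1 adj_counit (F (U B))) (pf1 F (ct1 adj_unit (U B)))
    • (ct2 adj_counit (ct1 adj_counit B) ▷ pf1 F (ct1 adj_unit (U B)))
    • asc (ct1 adj_counit B) (pf1 F (pf1 U (ct1 adj_counit B))) (pf1 F (ct1 adj_unit (U B)))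
    • (ct1 adj_counit B
       ◁ (gam F (pf1 U (ct1 adj_counit B)) (ct1 adj_unit (U B))
          • pf2 F (adj_Phi B) • ioti F (U B)))
    • runi (ct1 adj_counit B)
    = id2 (ct1 adj_counit B)
}.

Record Biadjunction (X Y : TwoCat) (F : Pseudofunctor X Y) (U : Pseudofunctor Y X) := {
  biadj :> ColaxAdjunction F U;
  biadj_unit : is_pseudonatural (adj_unit biadj);
  biadj_counit : is_pseudonatural (adj_counit biadj);
  biadj_Psi : forall A : X, is_iso (adj_Psi biadj A);
  biadj_Phi : forall B : Y, is_iso (adj_Phi biadj B)
}.

(** * Left Kan extensions *)

(** [u] exhibits [l] as a left Kan extension of [f] along [y]. *)
Definition IsLan (K : TwoCat) (A B C : K) (y : hom A B) (f : hom A C) (l : hom B C)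
    (u : f ⇒ l ∘ y) : Prop :=
  forall (k : hom B C) (b : f ⇒ k ∘ y), exists! s : l ⇒ k, (s ▷ y) • u = b.

Definition PreservesLan (K : TwoCat) (A B C E : K) (g : hom C E) (y : hom A B)
    (f : hom A C) (l : hom B C) (u : f ⇒ l ∘ y) : Prop :=
  IsLan (y := y) (f := g ∘ f) (l := g ∘ l) (asc g l y • (g ◁ u)).

Section Lan.
Variable K : TwoCat.
Variables (A B C : K) (y : hom A B).

Lemma is_iso_eqcell (A' B' : K) (f g : hom A' B') (e : f = g) : is_iso (eqcell e).
Proof. by exists (eqcell (eq_sym e)); rewrite !eqcellM !eqcell1. Qed.

Lemma is_iso_comp (A' B' : K) (f g h : hom A' B') (b : g ⇒ h) (a : f ⇒ g) :
  is_iso b -> is_iso a -> is_iso (b • a).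
Proof.
move=> [b' [b'b bb']] [a' [a'a aa']]; exists (a' • b'); split.
  by rewrite -vcompA (vcompA b') b'b vcomp1l.
by rewrite -vcompA (vcompA a) aa' vcomp1l.
Qed.

Lemma is_iso_lw (A' B' C' : K) (g : hom B' C') (f f' : hom A' B') (a : f ⇒ f') :
  is_iso a -> is_iso (g ◁ a).
Proof. by move=> [b [ba ab]]; exists (g ◁ b); rewrite -!lwM ba ab !hcomp_id. Qed.

Lemma is_iso_rw (A' B' C' : K) (g g' : hom B' C') (f : hom A' B') (a : g ⇒ g') :
  is_iso a -> is_iso (a ▷ f).
Proof. by move=> [b [ba ab]]; exists (b ▷ f); rewrite -!rwM ba ab !hcomp_id. Qed.

Lemma lan_ext (f : hom A C) (l : hom B C) (u : f ⇒ l ∘ y) (k : hom B C) (s s' : l ⇒ k) :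
  IsLan u -> s ▷ y • u = s' ▷ y • u -> s = s'.
Proof. by move=> /(_ _ (s' ▷ y • u)) [t [_ tU]] e; rewrite -(tU s e) (tU s'). Qed.

Lemma lan_change (f f' : hom A C) (l l' : hom B C) (u : f ⇒ l ∘ y)
    (i : f' ⇒ f) (j : l ⇒ l') (u' : f' ⇒ l' ∘ y) :
  is_iso i -> is_iso j -> u' = j ▷ y • u • i -> IsLan u -> IsLan u'.
Proof.
move=> [i' [i'i ii']] [j' [j'j jj']] -> H k b.
have [s [sE sU]] := H k (b • i').
exists (s • j'); split.
  rewrite rwM -!vcompA (vcompA (j' ▷ y)) -rwM j'j hcomp_id vcomp1l vcompA sE.
  by rewrite -vcompA i'i vcomp1r.
move=> t tE; rewrite (sU (t • j)); last by rewrite -vcompA jj' vcomp1r.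
by rewrite -tE rwM -!vcompA ii' vcomp1r.
Qed.

Lemma lan_iso (f : hom A C) (l l' : hom B C) (u : f ⇒ l ∘ y) (u' : f ⇒ l' ∘ y) (s : l ⇒ l') :
  IsLan u -> IsLan u' -> s ▷ y • u = u' -> is_iso s.
Proof.
move=> Hu Hu' sE; have [t [tE _]] := Hu' _ u; exists t; split.
  by apply: (lan_ext Hu); rewrite rwM -vcompA sE tE hcomp_id vcomp1l.
by apply: (lan_ext Hu'); rewrite rwM -vcompA tE sE hcomp_id vcomp1l.
Qed.

Definition lan_desc (f : hom A C) (l : hom B C) (u : f ⇒ l ∘ y) (H : IsLan u)
    (k : hom B C) (b : f ⇒ k ∘ y) : l ⇒ k :=
  proj1_sig (constructive_indefinite_description _ (H k b)).

Lemma lan_descE (f : hom A C) (l : hom B C) (u : f ⇒ l ∘ y) (H : IsLan u)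
    (k : hom B C) (b : f ⇒ k ∘ y) : lan_desc H b ▷ y • u = b.
Proof. by rewrite /lan_desc; case: constructive_indefinite_description => s []. Qed.

End Lan.

Lemma preserves_id (K : TwoCat) (A B C : K) (y : hom A B) (f : hom A C) (l : hom B C)
    (u : f ⇒ l ∘ y) : IsLan u -> PreservesLan (id1 C) u.
Proof.
apply: (lan_change (i := lun f) (j := luni l)); first exact: is_iso_eqcell.
  exact: is_iso_eqcell.
by nf; congr (_ • _); exact: eqcell_irr.
Qed.

(** Preservation does not depend on the choice of the left Kan extension. *)
Lemma preserves_change (K : TwoCat) (A B C E : K) (g : hom C E) (y : hom A B)
    (f : hom A C) (l l' : hom B C) (u : f ⇒ l ∘ y) (u' : f ⇒ l' ∘ y) :
  IsLan u -> IsLan u' -> PreservesLan g u -> PreservesLan g u'.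
Proof.
move=> Hu Hu'.
pose s := lan_desc Hu u'; have sE : s ▷ y • u = u' := lan_descE Hu u'.
apply: (lan_change (i := id2 _) (j := g ◁ s)).
- by exists (id2 _); rewrite vcomp1l.
- by apply: is_iso_lw; exact: lan_iso Hu Hu' sE.
- rewrite -sE; nf; congr (_ • _); exact: eqcell_irr.
Qed.

Lemma preserves_comp (K : TwoCat) (A B C E F : K) (h : hom E F) (g : hom C E) (y : hom A B)
    (f : hom A C) (l : hom B C) (u : f ⇒ l ∘ y) (m : hom B E) (v : g ∘ f ⇒ m ∘ y) :
  PreservesLan g u -> IsLan v -> PreservesLan h v -> PreservesLan (h ∘ g) u.
Proof.
move=> Hg Hv Hh; have := preserves_change Hv Hg Hh.
apply: (lan_change (i := asci h g f) (j := asc h g l)); first exact: is_iso_eqcell.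
  exact: is_iso_eqcell.
by nf; congr (_ • _); exact: eqcell_irr.
Qed.

(** * Left Kan pseudomonads and their algebras *)

Record LeftKanPseudomonad (K : TwoCat) := {
  D0 : K -> K;
  Dy : forall A : K, hom A (D0 A);
  Dext : forall (A B : K), hom A (D0 B) -> hom (D0 A) (D0 B);
  Dcell : forall (A B : K) (f : hom A (D0 B)), f ⇒ Dext f ∘ Dy A;
  Dcell_iso : forall (A B : K) (f : hom A (D0 B)), is_iso (Dcell f);
  Dcell_lan : forall (A B : K) (f : hom A (D0 B)), IsLan (Dcell f);
  Dy_lan : forall A : K, IsLan (y := Dy A) (f := Dy A) (l := id1 (D0 A)) (luni (Dy A));
  Dext_preserves : forall (A B C : K) (g : hom B (D0 C)) (f : hom A (D0 B)),
    PreservesLan (Dext g) (Dcell f)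
}.
Arguments D0 {K} D A : rename.
Arguments Dy {K} D A : rename.
Arguments Dext {K} D {A B} f : rename.
Arguments Dcell {K} D {A B} f : rename.
Arguments Dcell_iso {K} D {A B} f : rename.
Arguments Dcell_lan {K} D {A B} f : rename.
Arguments Dy_lan {K} D A : rename.
Arguments Dext_preserves {K} D {A B C} g f : rename.

Section Algebras.
Variables (K : TwoCat) (D : LeftKanPseudomonad K).

Record PseudoAlgebra := {
  carrier :> K;
  aext : forall B : K, hom B carrier -> hom (D0 D B) carrier;
  acell : forall (B : K) (f : hom B carrier), f ⇒ aext f ∘ Dy D B;
  acell_iso : forall (B : K) (f : hom B carrier), is_iso (acell f);
  acell_lan : forall (B : K) (f : hom B carrier), IsLan (acell f);
  aext_preserves : forall (A B : K) (g : hom B carrier) (f : hom A (D0 D B)),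
    PreservesLan (aext g) (Dcell D f)
}.

Arguments aext C {B} f : rename.
Arguments acell C {B} f : rename.
Arguments acell_lan C {B} f : rename.

Record PseudoMorphism (C X : PseudoAlgebra) := {
  pm :> hom (carrier C) (carrier X);
  pm_preserves : forall (B : K) (f : hom B (carrier C)), PreservesLan pm (acell C f)
}.

Arguments pm_preserves {C X} p {B} f : rename.

Lemma pm_eq (C X : PseudoAlgebra) (f g : PseudoMorphism C X) : pm f = pm g -> f = g.
Proof.
case: f g => [f Hf] [g Hg] /= e; case: g / e Hg => Hg.
by rewrite (proof_irrelevance _ Hf Hg).
Qed.

Definition pm_id (C : PseudoAlgebra) : PseudoMorphism C C := {|
  pm := id1 (carrier C);
  pm_preserves := fun B f => preserves_id (acell_lan C f)
|}.

Definition pm_comp (C X Z : PseudoAlgebra) (g : PseudoMorphism X Z) (f : PseudoMorphism C X) :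
    PseudoMorphism C Z := {|
  pm := pm g ∘ pm f;
  pm_preserves := fun B k =>
    preserves_comp (pm_preserves f k) (acell_lan X (pm f ∘ k)) (pm_preserves g (pm f ∘ k))
|}.

Definition PsAlgData : TwoCatData := {|
  ob := PseudoAlgebra;
  hom := PseudoMorphism;
  cell := fun C X f g => pm f ⇒ pm g;
  id1 := pm_id;
  comp1 := pm_comp;
  id2 := fun C X f => id2 (pm f);
  vcomp := fun C X f g h b a => b • a;
  hcomp := fun C X Z g g' f f' b a => b ⋆ a
|}.

Lemma PsAlg_eqcell (C X : PsAlgData) (f g : hom C X) (e : f = g) (e' : pm f = pm g) :
  eqcell e = eqcell (K := K) e'.
Proof. by case: g / e e' => e'; rewrite eqcell1. Qed.

Lemma PsAlg_comp1A (A B C E : PsAlgData) (h : hom C E) (g : hom B C) (f : hom A B) :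
  h ∘ (g ∘ f) = (h ∘ g) ∘ f.
Proof. by apply: pm_eq; exact: comp1A. Qed.
Lemma PsAlg_comp1l (A B : PsAlgData) (f : hom A B) : id1 B ∘ f = f.
Proof. by apply: pm_eq; exact: comp1l. Qed.
Lemma PsAlg_comp1r (A B : PsAlgData) (f : hom A B) : f ∘ id1 A = f.
Proof. by apply: pm_eq; exact: comp1r. Qed.

Lemma PsAlg_laws : TwoCatLaws PsAlgData.
Proof.
refine (@Build_TwoCatLaws PsAlgData _ _ _ _ _ PsAlg_comp1A PsAlg_comp1l PsAlg_comp1r _ _ _).
- move=> *; exact: (vcompA (K := K)).
- move=> *; exact: (vcomp1l (K := K)).
- move=> *; exact: (vcomp1r (K := K)).
- move=> *; exact: (hcomp_id (K := K)).
- move=> *; exact: (hcomp_vcomp (K := K)).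
- move=> A B C E h h' g g' f f' c b a.
  rewrite (PsAlg_eqcell (PsAlg_comp1A h g f) (comp1A (pm h) (pm g) (pm f))).
  rewrite (PsAlg_eqcell (PsAlg_comp1A h' g' f') (comp1A (pm h') (pm g') (pm f'))).
  have := hcompA_ (tc_laws K) c b a.
  by rewrite (eqcell_irr _ (comp1A (pm h) (pm g) (pm f)))
    (eqcell_irr _ (comp1A (pm h') (pm g') (pm f'))).
- move=> A B f f' a.
  rewrite (PsAlg_eqcell (PsAlg_comp1l f) (comp1l (pm f)))
    (PsAlg_eqcell (PsAlg_comp1l f') (comp1l (pm f'))).
  have := hcomp1l_ (tc_laws K) a.
  by rewrite (eqcell_irr _ (comp1l (pm f))) (eqcell_irr _ (comp1l (pm f'))).
- move=> A B f f' a.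
  rewrite (PsAlg_eqcell (PsAlg_comp1r f) (comp1r (pm f)))
    (PsAlg_eqcell (PsAlg_comp1r f') (comp1r (pm f'))).
  have := hcomp1r_ (tc_laws K) a.
  by rewrite (eqcell_irr _ (comp1r (pm f))) (eqcell_irr _ (comp1r (pm f'))).
Qed.

End Algebras.
Arguments pm_preserves {K D C X} p {B} f : rename.
Arguments aext {K D} C {B} f : rename.
Arguments acell {K D} C {B} f : rename.

(** * The 2-category of pseudoalgebras, the Kleisli 2-category *)

Definition PsAlg (K : TwoCat) (D : LeftKanPseudomonad K) : TwoCat :=
  {| tc_data := PsAlgData D; tc_laws := PsAlg_laws D |}.

(** The full sub-2-category of [X] on a family of objects. *)
Definition FullSubData (X : TwoCat) (I : Type) (o : I -> X) : TwoCatData := {|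
  ob := I;
  hom := fun i j => hom (o i) (o j);
  cell := fun i j f g => f ⇒ g;
  id1 := fun i => id1 (o i);
  comp1 := fun i j k g f => g ∘ f;
  id2 := fun i j f => id2 f;
  vcomp := fun i j f g h b a => b • a;
  hcomp := fun i j k g g' f f' b a => b ⋆ a
|}.

Lemma FullSub_laws (X : TwoCat) (I : Type) (o : I -> X) : TwoCatLaws (FullSubData o).
Proof.
refine (@Build_TwoCatLaws (FullSubData o) _ _ _ _ _
  (fun A B C E => @comp1A X (o A) (o B) (o C) (o E))
  (fun A B => @comp1l X (o A) (o B)) (fun A B => @comp1r X (o A) (o B)) _ _ _).
- move=> *; exact: (vcompA (K := X)).
- move=> *; exact: (vcomp1l (K := X)).
- move=> *; exact: (vcomp1r (K := X)).
- move=> *; exact: (hcomp_id (K := X)).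
- move=> *; exact: (hcomp_vcomp (K := X)).
- move=> A B C E h h' g g' f f' c b a; have := hcompA_ (tc_laws X) c b a.
  rewrite (eqcell_irr _ (comp1A h g f)) (eqcell_irr _ (comp1A h' g' f')); exact.
- move=> A B f f' a; have := hcomp1l_ (tc_laws X) a.
  rewrite (eqcell_irr _ (comp1l f)) (eqcell_irr _ (comp1l f')); exact.
- move=> A B f f' a; have := hcomp1r_ (tc_laws X) a.
  rewrite (eqcell_irr _ (comp1r f)) (eqcell_irr _ (comp1r f')); exact.
Qed.

Definition FullSub (X : TwoCat) (I : Type) (o : I -> X) : TwoCat :=
  {| tc_data := FullSubData o; tc_laws := FullSub_laws o |}.

Definition full_sub_incl_data (X : TwoCat) (I : Type) (o : I -> X) : PFData (FullSub o) X := {|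
  pf_map := {| pf0 := o : FullSub o -> X; pf1 := fun A B f => f |};
  pf2 := fun A B f g a => a;
  gam := fun A B C g f => id2 (g ∘ f);
  gami := fun A B C g f => id2 (g ∘ f);
  iot := fun A => id2 (id1 (o A));
  ioti := fun A => id2 (id1 (o A))
|}.

Lemma full_sub_incl_laws (X : TwoCat) (I : Type) (o : I -> X) :
  PFLaws (full_sub_incl_data o).
Proof.
split=> /= *; rewrite ?hcomp_id ?vcomp1l ?vcomp1r //; exact: eqcell_irr.
Qed.

Definition full_sub_incl (X : TwoCat) (I : Type) (o : I -> X) : Pseudofunctor (FullSub o) X :=
  {| pf_data := full_sub_incl_data o; pf_laws := full_sub_incl_laws o |}.

Section FreeForgetful.
Variables (K : TwoCat) (D : LeftKanPseudomonad K).

Definition forgetful_data : PFData (PsAlg D) K := {|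
  pf_map := {| pf0 := fun C : PsAlg D => carrier C; pf1 := fun C X f => pm f |};
  pf2 := fun C X f g a => a;
  gam := fun C X Z g f => id2 (pm g ∘ pm f);
  gami := fun C X Z g f => id2 (pm g ∘ pm f);
  iot := fun C => id2 (id1 (carrier C));
  ioti := fun C => id2 (id1 (carrier C))
|}.

Lemma forgetful_laws : PFLaws forgetful_data.
Proof.
split; try by move=> /= *; rewrite ?hcomp_id ?vcomp1l ?vcomp1r.
- move=> A B C E h g f /=; rewrite !hcomp_id !vcomp1l !vcomp1r; symmetry.
  exact (PsAlg_eqcell (@comp1A (PsAlg D) _ _ _ _ h g f) (comp1A (pm h) (pm g) (pm f))).
- move=> A B f /=; rewrite !hcomp_id !vcomp1r; symmetry.
  exact (PsAlg_eqcell (@comp1l (PsAlg D) _ _ f) (comp1l (pm f))).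
- move=> A B f /=; rewrite !hcomp_id !vcomp1r; symmetry.
  exact (PsAlg_eqcell (@comp1r (PsAlg D) _ _ f) (comp1r (pm f))).
Qed.

(** [U^D] *)
Definition forgetful : Pseudofunctor (PsAlg D) K :=
  {| pf_data := forgetful_data; pf_laws := forgetful_laws |}.

Definition free_alg (A : K) : PseudoAlgebra D := {|
  carrier := D0 D A;
  aext := fun B f => Dext D f;
  acell := fun B f => Dcell D f;
  acell_iso := fun B f => Dcell_iso D f;
  acell_lan := fun B f => Dcell_lan D f;
  aext_preserves := fun A' B g f => Dext_preserves D g f
|}.

(** [K_D], the full sub-2-category of [PsAlg D] on the free algebras; as a family, so that its
    objects are those of [K], with [A] standing for the free algebra on [A]. *)
Definition Kleisli : TwoCat := FullSub (X := PsAlg D) free_alg.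

Definition Kleisli_incl : Pseudofunctor Kleisli (PsAlg D) :=
  full_sub_incl (X := PsAlg D) free_alg.

Definition J1 (A B : K) (f : hom A B) : PseudoMorphism (free_alg A) (free_alg B) :=
  @Build_PseudoMorphism K D (free_alg A) (free_alg B) (Dext D (Dy D B ∘ f))
    (fun A' k => Dext_preserves D (Dy D B ∘ f) k).

Definition Jcell (A B : K) (f : hom A B) : Dy D B ∘ f ⇒ J1 f ∘ Dy D A := Dcell D (Dy D B ∘ f).

Lemma Jcell_lan (A B : K) (f : hom A B) : IsLan (Jcell f).
Proof. exact: Dcell_lan. Qed.
Arguments Jcell_lan {A B} f.

Definition J2 (A B : K) (f g : hom A B) (a : f ⇒ g) : pm (J1 f) ⇒ pm (J1 g) :=
  lan_desc (Jcell_lan f) (Jcell g • (Dy D B ◁ a)).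

Definition Jgam_restr (A B C : K) (g : hom B C) (f : hom A B) :
    Dy D C ∘ (g ∘ f) ⇒ (J1 g ∘ J1 f) ∘ Dy D A :=
  asc (pm (J1 g)) (J1 f) (Dy D A)
  • (J1 g ◁ Jcell f)
  • asci (pm (J1 g)) (Dy D B) f
  • (Jcell g ▷ f)
  • asc (Dy D C) g f.

Definition Jiot_restr (A : K) : Dy D A ∘ id1 A ⇒ id1 (D0 D A) ∘ Dy D A :=
  luni (Dy D A) • run (Dy D A).

Lemma Jgam_restr_lan (A B C : K) (g : hom B C) (f : hom A B) : IsLan (Jgam_restr g f).
Proof.
have H : IsLan (asc (pm (J1 g)) (J1 f) (Dy D A) • (J1 g ◁ Jcell f)).
  exact: (Dext_preserves D).
move: H; apply: (lan_change (j := id2 _)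
  (i := asci (pm (J1 g)) (Dy D B) f • (Jcell g ▷ f) • asc (Dy D C) g f)).
- apply: is_iso_comp; last exact: is_iso_eqcell.
  apply: is_iso_comp; first exact: is_iso_eqcell.
  by apply: is_iso_rw; exact: Dcell_iso.
- exact: (is_iso_eqcell eq_refl).
- by rewrite hcomp_id vcomp1l /Jgam_restr !vcompA.
Qed.

Arguments Jgam_restr_lan {A B C} g f.

Lemma Jiot_restr_lan (A : K) : IsLan (Jiot_restr A).
Proof.
apply: (lan_change (j := id2 _) (i := run (Dy D A))) (Dy_lan D A).
- exact: is_iso_eqcell.
- exact: (is_iso_eqcell eq_refl).
- by rewrite hcomp_id vcomp1l.
Qed.

Arguments Jiot_restr_lan A : clear implicits.

Definition Jgam (A B C : K) (g : hom B C) (f : hom A B) : pm (J1 (g ∘ f)) ⇒ J1 g ∘ J1 f :=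
  lan_desc (Jcell_lan (g ∘ f)) (Jgam_restr g f).

Definition Jgami (A B C : K) (g : hom B C) (f : hom A B) : J1 g ∘ J1 f ⇒ pm (J1 (g ∘ f)) :=
  lan_desc (Jgam_restr_lan g f) (Jcell (g ∘ f)).

Definition Jiot (A : K) : pm (J1 (id1 A)) ⇒ id1 (D0 D A) :=
  lan_desc (Jcell_lan (id1 A)) (Jiot_restr A).

Definition Jioti (A : K) : id1 (D0 D A) ⇒ pm (J1 (id1 A)) :=
  lan_desc (Jiot_restr_lan A) (Jcell (id1 A)).

Lemma J2E (A B : K) (f g : hom A B) (a : f ⇒ g) :
  J2 a ▷ Dy D A • Jcell f = Jcell g • (Dy D B ◁ a).
Proof. exact: lan_descE. Qed.
Lemma JgamE (A B C : K) (g : hom B C) (f : hom A B) :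
  Jgam g f ▷ Dy D A • Jcell (g ∘ f) = Jgam_restr g f.
Proof. exact: lan_descE. Qed.
Lemma JgamiE (A B C : K) (g : hom B C) (f : hom A B) :
  Jgami g f ▷ Dy D A • Jgam_restr g f = Jcell (g ∘ f).
Proof. exact: lan_descE. Qed.
Lemma JiotE (A : K) : Jiot A ▷ Dy D A • Jcell (id1 A) = Jiot_restr A.
Proof. exact: lan_descE. Qed.
Lemma JiotiE (A : K) : Jioti A ▷ Dy D A • Jiot_restr A = Jcell (id1 A).
Proof. exact: lan_descE. Qed.

Lemma J2_id (A B : K) (f : hom A B) : J2 (id2 f) = id2 (pm (J1 f)).
Proof. by apply: (lan_ext (Jcell_lan f)); rewrite J2E !hcomp_id vcomp1l vcomp1r. Qed.

Lemma J2_comp (A B : K) (f g h : hom A B) (b : g ⇒ h) (a : f ⇒ g) :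
  J2 (b • a) = J2 b • J2 a.
Proof.
by apply: (lan_ext (Jcell_lan f)); rewrite J2E rwM -vcompA J2E vcompA J2E lwM vcompA.
Qed.

Lemma JgamK (A B C : K) (g : hom B C) (f : hom A B) : Jgami g f • Jgam g f = id2 _.
Proof.
by apply: (lan_ext (Jcell_lan _)); rewrite rwM -vcompA JgamE JgamiE hcomp_id vcomp1l.
Qed.
Lemma JgamiK (A B C : K) (g : hom B C) (f : hom A B) : Jgam g f • Jgami g f = id2 _.
Proof.
by apply: (lan_ext (Jgam_restr_lan g f)); rewrite rwM -vcompA JgamiE JgamE hcomp_id vcomp1l.
Qed.
Lemma JiotK (A : K) : Jioti A • Jiot A = id2 _.
Proof.
by apply: (lan_ext (Jcell_lan _)); rewrite rwM -vcompA JiotE JiotiE hcomp_id vcomp1l.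
Qed.
Lemma JiotiK (A : K) : Jiot A • Jioti A = id2 _.
Proof.
by apply: (lan_ext (Jiot_restr_lan A)); rewrite rwM -vcompA JiotiE JiotE hcomp_id vcomp1l.
Qed.

Lemma Jgam_nat (A B C : K) (g g' : hom B C) (f f' : hom A B) (b : g ⇒ g') (a : f ⇒ f') :
  Jgam g' f' • J2 (b ⋆ a) = (J2 b ⋆ J2 a) • Jgam g f.
Proof.
apply: (lan_ext (Jcell_lan _)); rewrite !rwM -!vcompA J2E JgamE vcompA JgamE.
rewrite (hcompE (J2 b)) rwM rw_lw rw_rw /Jgam_restr.
transitivity (asc (pm (J1 g')) (J1 f') (Dy D A) • (J2 b ▷ (J1 f' ∘ Dy D A))
  • (J1 g ◁ (J2 a ▷ Dy D A • Jcell f)) • asci (pm (J1 g)) (Dy D B) f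
  • (Jcell g ▷ f) • asc (Dy D C) g f); last by nf; fin.
rewrite J2E lwM.
transitivity (asc (pm (J1 g')) (J1 f') (Dy D A)
  • (J2 b ▷ (J1 f' ∘ Dy D A) • J1 g ◁ Jcell f')
  • (J1 g ◁ (Dy D B ◁ a)) • asci (pm (J1 g)) (Dy D B) f
  • (Jcell g ▷ f) • asc (Dy D C) g f); last by nf; fin.
rewrite interchange.
transitivity (asc (pm (J1 g')) (J1 f') (Dy D A) • (J1 g' ◁ Jcell f')
  • asci (pm (J1 g')) (Dy D B) f' • ((J2 b ▷ Dy D B) ▷ f')
  • ((J1 g ∘ Dy D B) ◁ a) • (Jcell g ▷ f) • asc (Dy D C) g f); last by nf; fin.
transitivity (asc (pm (J1 g')) (J1 f') (Dy D A) • (J1 g' ◁ Jcell f')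
  • asci (pm (J1 g')) (Dy D B) f' • ((J2 b ▷ Dy D B) ▷ f')
  • ((Jcell g ▷ f') • ((Dy D C ∘ g) ◁ a)) • asc (Dy D C) g f);
  last by rewrite interchange !vcompA.
transitivity (asc (pm (J1 g')) (J1 f') (Dy D A) • (J1 g' ◁ Jcell f')
  • asci (pm (J1 g')) (Dy D B) f' • ((J2 b ▷ Dy D B • Jcell g) ▷ f')
  • ((Dy D C ∘ g) ◁ a) • asc (Dy D C) g f); last by rewrite (rwM f' (J2 b ▷ _)) !vcompA.
by rewrite J2E (hcompE b); nf; fin.
Qed.

Lemma Jgam_assoc (A B C E : K) (h : hom C E) (g : hom B C) (f : hom A B) :
  asc (pm (J1 h)) (J1 g) (J1 f) • (J1 h ◁ Jgam g f) • Jgam h (g ∘ f)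
  = (Jgam h g ▷ J1 f) • Jgam (h ∘ g) f • J2 (asc h g f).
Proof.
apply: (lan_ext (Jcell_lan _)); rewrite !rwM -!vcompA J2E JgamE.
rewrite (vcompA (Jgam (h ∘ g) f ▷ _)) JgamE /Jgam_restr.
transitivity (asc (pm (J1 h)) (J1 g) (J1 f) ▷ Dy D A
  • asc (pm (J1 h)) (J1 g ∘ J1 f) (Dy D A) • (J1 h ◁ (Jgam g f ▷ Dy D A • Jcell (g ∘ f)))
  • asci (pm (J1 h)) (Dy D C) (g ∘ f) • (Jcell h ▷ (g ∘ f)) • asc (Dy D E) h (g ∘ f)).
  by rewrite rw_lw; nf; fin.
symmetry.
transitivity (asc (pm (J1 h) ∘ J1 g) (J1 f) (Dy D A)
  • (Jgam h g ▷ (J1 f ∘ Dy D A) • J1 (h ∘ g) ◁ Jcell f)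
  • asci (pm (J1 (h ∘ g))) (Dy D B) f • (Jcell (h ∘ g) ▷ f)
  • asc (Dy D E) (h ∘ g) f • (Dy D E ◁ asc h g f)).
  by nf; fin.
rewrite interchange.
transitivity (asc (pm (J1 h) ∘ J1 g) (J1 f) (Dy D A)
  • ((pm (J1 h) ∘ J1 g) ◁ Jcell f) • asci (pm (J1 h) ∘ J1 g) (Dy D B) f
  • ((Jgam h g ▷ Dy D B • Jcell (h ∘ g)) ▷ f)
  • asc (Dy D E) (h ∘ g) f • (Dy D E ◁ asc h g f)).
  by nf; fin.
by rewrite !JgamE /Jgam_restr; nf; fin.
Qed.

Lemma Jgam_idl (A B : K) (f : hom A B) :
  lun (pm (J1 f)) • (Jiot B ▷ J1 f) • Jgam (id1 B) f = J2 (lun f).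
Proof.
apply: (lan_ext (Jcell_lan _)); rewrite !rwM -!vcompA J2E JgamE /Jgam_restr.
transitivity (lun (J1 f ∘ Dy D A)
  • (Jiot B ▷ (J1 f ∘ Dy D A) • J1 (id1 B) ◁ Jcell f)
  • asci (pm (J1 (id1 B))) (Dy D B) f • (Jcell (id1 B) ▷ f) • asc (Dy D B) (id1 B) f).
  by nf; fin.
rewrite interchange.
transitivity (lun (J1 f ∘ Dy D A) • (id1 (D0 D B) ◁ Jcell f) • asci (id1 (D0 D B)) (Dy D B) f
  • ((Jiot B ▷ Dy D B • Jcell (id1 B)) ▷ f) • asc (Dy D B) (id1 B) f).
  by nf; fin.
by rewrite JiotE /Jiot_restr; nf; fin.
Qed.

Lemma Jgam_idr (A B : K) (f : hom A B) :
  run (pm (J1 f)) • (J1 f ◁ Jiot A) • Jgam f (id1 A) = J2 (run f).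
Proof.
apply: (lan_ext (Jcell_lan _)); rewrite !rwM -!vcompA J2E JgamE /Jgam_restr.
transitivity (run (pm (J1 f)) ▷ Dy D A • asc (pm (J1 f)) (id1 (D0 D A)) (Dy D A)
  • (J1 f ◁ (Jiot A ▷ Dy D A • Jcell (id1 A)))
  • asci (pm (J1 f)) (Dy D A) (id1 A) • (Jcell f ▷ id1 A) • asc (Dy D B) f (id1 A)).
  by nf; fin.
by rewrite JiotE /Jiot_restr; nf; fin.
Qed.

Definition J_data : PFData K Kleisli := {|
  pf_map := @Build_PFMap K Kleisli (fun A => A) (fun A B f => J1 f);
  pf2 := fun A B f g a => J2 a;
  gam := fun A B C g f => Jgam g f;
  gami := fun A B C g f => Jgami g f;
  iot := fun A => Jiot A;
  ioti := fun A => Jioti A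
|}.

Lemma J_laws : PFLaws J_data.
Proof.
split.
- exact: J2_id.
- exact: J2_comp.
- exact: JgamK.
- exact: JgamiK.
- exact: JiotK.
- exact: JiotiK.
- exact: Jgam_nat.
- move=> A B C E h g f; refine (eq_trans _ (Jgam_assoc h g f)).
  have := PsAlg_eqcell (@comp1A Kleisli A B C E (J1 h) (J1 g) (J1 f))
    (comp1A (pm (J1 h)) (J1 g) (J1 f)).
  by rewrite /asc => <-.
- move=> A B f; refine (eq_trans _ (Jgam_idl f)).
  have := PsAlg_eqcell (@comp1l Kleisli A B (J1 f)) (comp1l (pm (J1 f))).
  by rewrite /lun => <-.
- move=> A B f; refine (eq_trans _ (Jgam_idr f)).
  have := PsAlg_eqcell (@comp1r Kleisli A B (J1 f)) (comp1r (pm (J1 f))).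
  by rewrite /run => <-.
Qed.

(** [J_D] *)
Definition J : Pseudofunctor K Kleisli := {| pf_data := J_data; pf_laws := J_laws |}.

(** [F^D] *)
Definition free : Pseudofunctor K (PsAlg D) := pf_comp Kleisli_incl J.

(** The 1-cells [y_A], with the invertible 2-cells [y_B f => (y_B f)^D y_A]. *)
Definition y_data : ColaxData (pf_id K) (pf_comp forgetful free) :=
  Build_ColaxData (pf_id K) (pf_comp forgetful free)
    (fun A => Dy D A) (fun A B f => Dcell D (Dy D B ∘ f)).

(** The free-forgetful biadjunction is the one whose unit is [y]; this determines the counit
    and the modifications up to a unique isomorphism. *)
Definition is_free_forgetful (B : Biadjunction free forgetful) : Prop :=
  ct_data (adj_unit B) = y_data.

(** [A] has the same counit as [B], and its unit at the free algebra on [a] is the image under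
    [J_D] of the unit of [B] at [a]. *)
Definition is_induced_by (B : Biadjunction free forgetful)
    (A : ColaxAdjunction Kleisli_incl (pf_comp J forgetful)) : Prop :=
  ct_data (adj_counit A) = ct_data (adj_counit B)
  /\ forall a : K, ct1 (adj_unit A) (J a) = pf1 J (ct1 (adj_unit B) a).

End FreeForgetful.

(* Main.v *)
From Corelib Require Import ssreflect.
Require Import Defs.

Set Implicit Arguments.
Unset Strict Implicit.
Unset Printing Implicit Defensive.

Open Scope twocat_scope.

(** A pseudomorphism [l : DA -> C] preserves the left Kan extension [1] of [y] along [y], hence
    is the left Kan extension of its own restriction [l y].  So restriction along [y] is a
    bijection from the 2-cells [l => k] to the 2-cells [l y => k y] ([free_lan], [free_ext]).
    The 2-cells constructed below, and the equations between them, rest on this fact.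

    For the free-forgetful biadjunction, the counit at [C] is [e_C = 1^C : DC -> C] and
    [Phi_C : 1 => e_C y] is the structure cell of [C].  The remaining data are forced: the
    naturality of [Phi] prescribes the restriction of [e_h : e_X Jh => h e_C] along [y], and the
    first triangle identity prescribes that of [Psi_A : e_DA Jy => 1].  The prescribed cells are
    invertible, hence so are [e_h] and [Psi_A].  The record [FreeCounit] isolates these data and
    these two axioms.  It is the same thing as an adjunction with unit [y] and invertible [Phi]
    ([free_adjunction], [free_counit_of]), and the induced adjunction is built from it.

    The induced colax adjunction keeps the counit and [Psi], takes [Jy_A : DA -> DDA] as unit,
    and takes [J Phi] as its [Phi].  The new datum is the 2-cell of the unit at a pseudomorphism
    [h : DA -> DB] that need not be of the form [Jf].  It comes from the lax idempotent structure
    [lam : Jy_A => y_DA], whose restriction along [y_A] is inverse to the structure cell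
    [y_DA y_A => Jy_A y_A].  Since [lam] becomes invertible after restriction, it can be cancelled
    against 2-cells out of a pseudomorphism ([lam_ext]), and the 2-cell [u_h] of the unit is the
    unique one with [(Jh lam) u_h = y_h (lam h)] ([kunit2E]), where [y_h : y_DB h => Jh y_DA] is
    the naturality cell of [y].  Hence every law for [u] becomes the corresponding law for [y]
    once [lam] is cancelled.  As [lam] itself need not be invertible, [u] is only colax.  Three
    identities link the two adjunctions:
    - [Phi Psi = e lam], which gives the naturality of [Psi] with respect to all
      pseudomorphisms ([Psi_mod_at]);
    - [(Je lam) (J Phi) = y_e tau], with [tau : 1 => y e] the extension of [y Phi], which gives
      the naturality of [J Phi] ([J_Phi_mod_at]);
    - [(y Psi) (tau Jy) = lam], which gives the triangle identity of the unit
      ([J_unit_triangle_at]).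
    The triangle identity of the counit is literally the same for both adjunctions.

    Associativity of 1-cells holds up to a propositional equality only.  To keep the coherence
    cells out of the calculations, a 2-cell [a : g f => k h] is evaluated at a 1-cell [z], as a
    family of 2-cells [g (f z) => k (h z)] natural in [z].  Between right-nested composites no
    coherence cell is needed, and one reasons as in the 2-category of categories, with [z] an
    object and 1-cells acting as functors. *)

(** * Two-cells evaluated at a 1-cell *)

Section Evaluation.
Variable K : TwoCat.

Fact evaluation_key : unit.
Proof. exact tt. Qed.

(** The evaluations are locked: they are opaque letters for the rewriting of long composites,
    which would otherwise see the composite inside each of them. *)
Definition sq_at (A B B' C : K) (g : hom B C) (f : hom A B) (k : hom B' C) (h : hom A B')
    (a : g ∘ f ⇒ k ∘ h) (Z : K) (z : hom Z A) : g ∘ (f ∘ z) ⇒ k ∘ (h ∘ z) :=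
  locked_with evaluation_key (asci k h z • (a ▷ z • asc g f z)).
Definition unit_at (A B : K) (e : hom B A) (j : hom A B) (a : id1 A ⇒ e ∘ j)
    (Z : K) (z : hom Z A) : z ⇒ e ∘ (j ∘ z) :=
  locked_with evaluation_key (asci e j z • (a ▷ z • luni z)).
Definition counit_at (A B : K) (e : hom B A) (j : hom A B) (a : e ∘ j ⇒ id1 A)
    (Z : K) (z : hom Z A) : e ∘ (j ∘ z) ⇒ z :=
  locked_with evaluation_key (lun z • (a ▷ z • asc e j z)).
Definition split_at (A B C : K) (p : hom A C) (g : hom B C) (f : hom A B) (a : p ⇒ g ∘ f)
    (Z : K) (z : hom Z A) : p ∘ z ⇒ g ∘ (f ∘ z) :=
  locked_with evaluation_key (asci g f z • a ▷ z).
Definition merge_at (A B C : K) (p : hom A C) (g : hom B C) (f : hom A B) (a : g ∘ f ⇒ p)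
    (Z : K) (z : hom Z A) : g ∘ (f ∘ z) ⇒ p ∘ z :=
  locked_with evaluation_key (a ▷ z • asc g f z).

Lemma sq_atE (A B B' C : K) (g : hom B C) (f : hom A B) (k : hom B' C) (h : hom A B')
    (a : g ∘ f ⇒ k ∘ h) (Z : K) (z : hom Z A) :
  sq_at a z = asci k h z • (a ▷ z • asc g f z).
Proof. exact: locked_withE. Qed.
Lemma unit_atE (A B : K) (e : hom B A) (j : hom A B) (a : id1 A ⇒ e ∘ j)
    (Z : K) (z : hom Z A) : unit_at a z = asci e j z • (a ▷ z • luni z).
Proof. exact: locked_withE. Qed.
Lemma counit_atE (A B : K) (e : hom B A) (j : hom A B) (a : e ∘ j ⇒ id1 A)
    (Z : K) (z : hom Z A) : counit_at a z = lun z • (a ▷ z • asc e j z).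
Proof. exact: locked_withE. Qed.
Lemma split_atE (A B C : K) (p : hom A C) (g : hom B C) (f : hom A B) (a : p ⇒ g ∘ f)
    (Z : K) (z : hom Z A) : split_at a z = asci g f z • a ▷ z.
Proof. exact: locked_withE. Qed.
Lemma merge_atE (A B C : K) (p : hom A C) (g : hom B C) (f : hom A B) (a : g ∘ f ⇒ p)
    (Z : K) (z : hom Z A) : merge_at a z = a ▷ z • asc g f z.
Proof. exact: locked_withE. Qed.
End Evaluation.

(** Reduces an equation to the decision of coherence, by unlocking the evaluations. *)
Ltac by_components := rewrite ?sq_atE ?unit_atE ?counit_atE ?split_atE ?merge_atE; nf; fin.

Ltac assoc_right := rewrite <- ?vcompA.

Section EvaluationTheory.
Variable K : TwoCat.

Lemma vcomp_pre (A B : K) (f g h k : hom A B) (c : h ⇒ k) (b : g ⇒ h) (d : g ⇒ k)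
    (a : f ⇒ g) : c • b = d -> c • (b • a) = d • a.
Proof. by move=> <-; rewrite vcompA. Qed.

Lemma vcomp_pre3 (A B : K) (f g h k l : hom A B) (d : k ⇒ l) (c : h ⇒ k) (b : g ⇒ h)
    (e : g ⇒ l) (a : f ⇒ g) : d • (c • b) = e -> d • (c • (b • a)) = e • a.
Proof. by move=> <-; rewrite !vcompA. Qed.

Lemma lwMA (A B C : K) (g : hom B C) (e : hom A C) (f f' f'' : hom A B)
    (a' : f' ⇒ f'') (a : f ⇒ f') (b : e ⇒ g ∘ f) :
  (g ◁ a') • ((g ◁ a) • b) = (g ◁ (a' • a)) • b.
Proof. by rewrite lwM vcompA. Qed.

Lemma iso_cancel (A B : K) (f g h : hom A B) (c : g ⇒ h) (a b : f ⇒ g) :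
  is_iso c -> c • a = c • b -> a = b.
Proof.
move=> [d [dc _]] e.
by rewrite -(vcomp1l a) -(vcomp1l b) -dc -!vcompA e.
Qed.

Lemma iso_cancelr (A B : K) (f g h : hom A B) (c : f ⇒ g) (a b : g ⇒ h) :
  is_iso c -> a • c = b • c -> a = b.
Proof.
move=> [d [_ cd]] e.
by rewrite -(vcomp1r a) -(vcomp1r b) -cd !vcompA e.
Qed.

Section Square.
Variables (A B B' C : K) (g : hom B C) (f : hom A B) (k : hom B' C) (h : hom A B').
Variable a : g ∘ f ⇒ k ∘ h.

Lemma sq_at_nat (Z : K) (z z' : hom Z A) (t : z ⇒ z') :
  sq_at a z' • (g ◁ (f ◁ t)) = (k ◁ (h ◁ t)) • sq_at a z.
Proof.
have E : a ▷ z' • (g ∘ f) ◁ t = (k ∘ h) ◁ t • a ▷ z by exact: interchange.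
transitivity (asci k h z' • (a ▷ z' • (g ∘ f) ◁ t) • asc g f z).
  by_components.
by rewrite E; by_components.
Qed.

Lemma whisker_sq_at (Z : K) (z : hom Z A) : a ▷ z = asc k h z • (sq_at a z • asci g f z).
Proof. by_components. Qed.
End Square.

Section Triangle.
Variables (A B : K) (e : hom B A) (j : hom A B).

Lemma unit_at_nat (a : id1 A ⇒ e ∘ j) (Z : K) (z z' : hom Z A) (t : z ⇒ z') :
  unit_at a z' • t = (e ◁ (j ◁ t)) • unit_at a z.
Proof.
have E : a ▷ z' • id1 A ◁ t = (e ∘ j) ◁ t • a ▷ z by exact: interchange.
transitivity (asci e j z' • (a ▷ z' • id1 A ◁ t) • luni z).
  by_components.
by rewrite E; by_components.
Qed.

Lemma counit_at_nat (a : e ∘ j ⇒ id1 A) (Z : K) (z z' : hom Z A) (t : z ⇒ z') :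
  counit_at a z' • (e ◁ (j ◁ t)) = t • counit_at a z.
Proof.
have E : a ▷ z' • (e ∘ j) ◁ t = id1 A ◁ t • a ▷ z by exact: interchange.
transitivity (lun z' • (a ▷ z' • (e ∘ j) ◁ t) • asc e j z).
  by_components.
by rewrite E; by_components.
Qed.

Lemma unit_at_iso (a : id1 A ⇒ e ∘ j) (Z : K) (z : hom Z A) : is_iso a -> is_iso (unit_at a z).
Proof.
rewrite unit_atE => H; apply: is_iso_comp; first exact: is_iso_eqcell.
by apply: is_iso_comp; [exact: is_iso_rw | exact: is_iso_eqcell].
Qed.
End Triangle.

Lemma sq_at_iso (A B B' C : K) (g : hom B C) (f : hom A B) (k : hom B' C) (h : hom A B')
    (a : g ∘ f ⇒ k ∘ h) (Z : K) (z : hom Z A) : is_iso a -> is_iso (sq_at a z).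
Proof.
rewrite sq_atE => H; apply: is_iso_comp; first exact: is_iso_eqcell.
by apply: is_iso_comp; [exact: is_iso_rw | exact: is_iso_eqcell].
Qed.
Lemma comp_ext (A B : K) (f g : hom A B) (s s' : f ⇒ g) :
  (forall (Z : K) (z : hom Z A), s ▷ z = s' ▷ z) -> s = s'.
Proof.
move=> E; have H t : t = run g • (t ▷ id1 A • runi f) by rewrite rw_id; nf.
by rewrite (H s) (H s') E.
Qed.

End EvaluationTheory.

(** * Restriction along [y] of 2-cells out of free algebras *)

Section Free.
Variables (K : TwoCat) (D : LeftKanPseudomonad K).
Notation y := (Dy D).
Notation PM := (PseudoMorphism (D := D)).

(** [l] preserves the Kan extension [(y_A)^D], hence also the extension [1] of [y_A] along
    itself, and [l 1] is [l]. *)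
Lemma free_lan (A : K) (C : PseudoAlgebra D) (l : PM (free_alg D A) C) :
  IsLan (id2 (pm l ∘ y A)).
Proof.
have H := preserves_change (Dcell_lan D (y A)) (Dy_lan D A) (pm_preserves l (y A)).
move: H; apply: (lan_change (i := id2 _) (j := run (pm l))).
- exact: (is_iso_eqcell eq_refl).
- exact: is_iso_eqcell.
- by nf; fin.
Qed.
Arguments free_lan {A C} l.

Lemma free_ext (A : K) (C : PseudoAlgebra D) (l : PM (free_alg D A) C)
    (k : hom (D0 D A) C) (s s' : pm l ⇒ k) : s ▷ y A = s' ▷ y A -> s = s'.
Proof. by move=> e; apply: (lan_ext (free_lan l)); rewrite e. Qed.

Lemma free_lan_iso (A : K) (C : PseudoAlgebra D) (l : PM (free_alg D A) C)
    (f : hom A C) (u : f ⇒ pm l ∘ y A) : is_iso u -> IsLan u.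
Proof.
move=> Hu; move: (free_lan l); apply: (lan_change (i := u) (j := id2 _)) => //.
- exact: (is_iso_eqcell eq_refl).
- by rewrite hcomp_id !vcomp1l.
Qed.

Lemma free_ext_comp (A : K) (C : PseudoAlgebra D) (l : PM (free_alg D A) C)
    (k : hom (D0 D A) C) (s s' : pm l ⇒ k) :
  (forall (Z : K) (z : hom Z A), s ▷ (y A ∘ z) = s' ▷ (y A ∘ z)) -> s = s'.
Proof.
move=> E; apply: free_ext; apply: comp_ext => Z z.
by rewrite !rw_rw E.
Qed.

Lemma free_ext_sq (A : K) (B B' C : PseudoAlgebra D) (g : PM B C) (f : PM (free_alg D A) B)
    (k : hom B' C) (h : hom (D0 D A) B') (s s' : pm g ∘ pm f ⇒ k ∘ h) :
  (forall (Z : K) (z : hom Z A), sq_at s (y A ∘ z) = sq_at s' (y A ∘ z)) -> s = s'.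
Proof.
by move=> E; apply: (free_ext_comp (l := pm_comp g f)) => Z z; rewrite !whisker_sq_at E.
Qed.

(** The naturality cell [y_B f => Jf y_A] of the unit, evaluated at [z]. *)
Notation η f z := (sq_at (Jcell D f) z).

Lemma eta_nat (A B : K) (f g : hom A B) (s : f ⇒ g) (Z : K) (z : hom Z A) :
  J2 D s ▷ (y A ∘ z) • η f z = η g z • (y B ◁ (s ▷ z)).
Proof.
transitivity (asci (pm (J1 D g)) (y A) z • ((J2 D s ▷ y A • Jcell D f) ▷ z)
   • asc (y B) f z); first by_components.
by rewrite J2E; by_components.
Qed.

(** The structure cells of [J] are defined by their restriction along [y].  Hence, evaluated on the
    image of [y], they compose, decompose, erase or create naturality cells of the unit, as this
    lemma and the next three say. *)
Lemma split_at_gam (A B C : K) (g : hom B C) (f : hom A B) (Z : K) (z : hom Z A) :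
  split_at (Jgam D g f) (y A ∘ z) • η (g ∘ f) z
  = (J1 D g ◁ η f z) • (η g (f ∘ z) • (y C ◁ asci g f z)).
Proof.
transitivity (asci _ _ _ • (asci _ _ _ • ((Jgam D g f ▷ y A • Jcell D (g ∘ f)) ▷ z)
   • asc (y C) (g ∘ f) z)); first by_components.
by rewrite JgamE /Jgam_restr; by_components.
Qed.

Lemma merge_at_gami (A B C : K) (g : hom B C) (f : hom A B) (Z : K) (z : hom Z A) :
  merge_at (Jgami D g f) (y A ∘ z) • ((J1 D g ◁ η f z) • η g (f ∘ z))
  = η (g ∘ f) z • (y C ◁ asc g f z).
Proof.
transitivity (asci _ _ _ • ((Jgami D g f ▷ y A • Jgam_restr D g f) ▷ z) •
   asc (y C) (g ∘ f) z • (y C ◁ asc g f z)); last first.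
  by rewrite JgamiE; by_components.
by rewrite /Jgam_restr; by_components.
Qed.

Lemma iot_eta (A : K) (Z : K) (z : hom Z A) :
  lun (y A ∘ z) • (Jiot D A ▷ (y A ∘ z) • η (id1 A) z) = y A ◁ lun z.
Proof.
transitivity (lun (y A ∘ z) • (asci _ _ _ • ((Jiot D A ▷ y A • Jcell D (id1 A)) ▷ z)
   • asc (y A) (id1 A) z)); first by_components.
by rewrite JiotE /Jiot_restr; nf; fin.
Qed.

Lemma ioti_eta (A : K) (Z : K) (z : hom Z A) :
  Jioti D A ▷ (y A ∘ z) • luni (y A ∘ z) = η (id1 A) z • (y A ◁ luni z).
Proof.
transitivity (asci _ _ _ • ((Jioti D A ▷ y A • Jiot_restr D A) ▷ z)
   • asc (y A) (id1 A) z • (y A ◁ luni z)); last by rewrite JiotiE; by_components.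
by rewrite /Jiot_restr; nf; fin.
Qed.

(** * Images under [J] of 2-cells between composites *)

(** The image of a 2-cell between composites is only defined up to the comparison cells of [J].
    Evaluated on the image of [y], these cells disappear: the three equations that follow are the
    naturality of [y] with respect to [a]. *)
Definition J_sq (A B B' C : K) (g : hom B C) (f : hom A B) (k : hom B' C) (h : hom A B')
  (a : g ∘ f ⇒ k ∘ h) : J1 D g ∘ J1 D f ⇒ J1 D k ∘ J1 D h :=
  Jgam D k h • J2 D a • Jgami D g f.
Definition J_unit (A B : K) (e : hom B A) (j : hom A B) (a : id1 A ⇒ e ∘ j) :
  id1 (D0 D A) ⇒ J1 D e ∘ J1 D j := Jgam D e j • J2 D a • Jioti D A.
Definition J_counit (A B : K) (e : hom B A) (j : hom A B) (a : e ∘ j ⇒ id1 A) :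
  J1 D e ∘ J1 D j ⇒ id1 (D0 D A) := Jiot D A • J2 D a • Jgami D e j.

Lemma J_sqE (A B B' C : K) (g : hom B C) (f : hom A B) (k : hom B' C) (h : hom A B')
    (a : g ∘ f ⇒ k ∘ h) (Z : K) (z : hom Z A) :
  sq_at (J_sq a) (y A ∘ z) • ((J1 D g ◁ η f z) • η g (f ∘ z))
  = (J1 D k ◁ η h z) • (η k (h ∘ z) • (y C ◁ sq_at a z)).
Proof.
transitivity (split_at (Jgam D k h) (y A ∘ z) • (J2 D a ▷ (y A ∘ z) •
   (merge_at (Jgami D g f) (y A ∘ z) • ((J1 D g ◁ η f z) • η g (f ∘ z))))).
  by rewrite /J_sq; by_components.
rewrite merge_at_gami (vcomp_pre _ (eta_nat _ _)); assoc_right.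
rewrite (vcomp_pre _ (split_at_gam _ _ _)).
by_components.
Qed.

Lemma J_unitE (A B : K) (e : hom B A) (j : hom A B) (a : id1 A ⇒ e ∘ j)
    (Z : K) (z : hom Z A) :
  unit_at (J_unit a) (y A ∘ z) = (J1 D e ◁ η j z) • (η e (j ∘ z) • (y A ◁ unit_at a z)).
Proof.
transitivity (split_at (Jgam D e j) (y A ∘ z) • (J2 D a ▷ (y A ∘ z) •
   (Jioti D A ▷ (y A ∘ z) • luni (y A ∘ z)))).
  by rewrite /J_unit; by_components.
rewrite ioti_eta (vcomp_pre _ (eta_nat _ _)); assoc_right.
rewrite (vcomp_pre _ (split_at_gam _ _ _)).
by_components.
Qed.

Lemma J_counitE (A B : K) (e : hom B A) (j : hom A B) (a : e ∘ j ⇒ id1 A)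
    (Z : K) (z : hom Z A) :
  counit_at (J_counit a) (y A ∘ z) • ((J1 D e ◁ η j z) • η e (j ∘ z)) = y A ◁ counit_at a z.
Proof.
transitivity (lun (y A ∘ z) • (Jiot D A ▷ (y A ∘ z) • (J2 D a ▷ (y A ∘ z) •
   (merge_at (Jgami D e j) (y A ∘ z) • ((J1 D e ◁ η j z) • η e (j ∘ z)))))).
  by rewrite /J_counit; by_components.
rewrite merge_at_gami (vcomp_pre _ (eta_nat _ _)); assoc_right.
transitivity ((lun (y A ∘ z) • (Jiot D A ▷ (y A ∘ z) • η (id1 A) z)) •
  ((y A ◁ (a ▷ z)) • (y A ◁ asc e j z))).
  by nf; fin.
by rewrite iot_eta; by_components.
Qed.

(** * The lax idempotent structure and the colax unit *)

(** [Jy_A => y_DA], extending the identity of [y_DA y_A]. *)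
Definition lam (A : K) : pm (J1 D (y A)) ⇒ y (D0 D A) :=
  lan_desc (Jcell_lan (D := D) (f := y A)) (id2 (y (D0 D A) ∘ y A)).

Lemma lamE (A : K) : lam A ▷ y A • Jcell D (y A) = id2 _.
Proof. exact: lan_descE. Qed.

Lemma lam_iso (A : K) : is_iso (lam A ▷ y A).
Proof.
have [i [iJ Ji]] := Dcell_iso D (y (D0 D A) ∘ y A).
exists (Jcell D (y A)); split; last exact: lamE.
have -> : lam A ▷ y A = i; last exact: Ji.
rewrite -(vcomp1l i) -(lamE A) -vcompA; symmetry; rewrite -[RHS]vcomp1r; congr (_ • _).
exact: Ji.
Qed.

Lemma lam_eta (A : K) (Z : K) (z : hom Z A) :
  lam A ▷ (y A ∘ z) • η (y A) z = id2 (y (D0 D A) ∘ (y A ∘ z)).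
Proof.
transitivity (asci _ _ _ • ((lam A ▷ y A • Jcell D (y A)) ▷ z • asc (y (D0 D A)) (y A) z)).
  by_components.
by rewrite lamE; nf; fin.
Qed.

Lemma lam_comp_iso (A : K) (Z : K) (z : hom Z A) : is_iso (lam A ▷ (y A ∘ z)).
Proof.
have -> : lam A ▷ (y A ∘ z) = asci _ _ _ • ((lam A ▷ y A) ▷ z • asc _ _ _) by by_components.
apply: is_iso_comp; first exact: is_iso_eqcell.
by apply: is_iso_comp; [apply: is_iso_rw; exact: lam_iso | exact: is_iso_eqcell].
Qed.

(** Restriction along [y_A] is injective on 2-cells out of [p], and makes [lam] invertible. *)
Lemma lam_ext (A : K) (X : PseudoAlgebra D) (p : PM (free_alg D A) X)
    (g : hom (D0 D (D0 D A)) X) (s s' : pm p ⇒ g ∘ J1 D (y A)) :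
  (g ◁ lam A) • s = (g ◁ lam A) • s' -> s = s'.
Proof.
move=> E; apply: free_ext.
apply: (iso_cancel (c := (g ◁ lam A) ▷ y A)); last by rewrite -!rwM E.
rewrite rw_lw; apply: is_iso_comp; first exact: is_iso_eqcell.
by apply: is_iso_comp; [apply: is_iso_lw; exact: lam_iso | exact: is_iso_eqcell].
Qed.

(** The restriction along [y_A] of the 2-cell of the unit at [h]: the composite
    [Jy_B h y_A => y_DB h y_A => Jh y_DA y_A => Jh Jy_A y_A] of [lam], of the naturality cell of
    [y] at [h], and of the inverse of the restriction of [lam]. *)
Definition kunit2_restr (A B : K) (h : PM (free_alg D A) (free_alg D B)) :
    (J1 D (y B) ∘ pm h) ∘ y A ⇒ (J1 D (pm h) ∘ J1 D (y A)) ∘ y A :=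
  asc (pm (J1 D (pm h))) (J1 D (y A)) (y A)
  • ((J1 D (pm h) ◁ Jcell D (y A)) • (sq_at (Jcell D (pm h) • (lam B ▷ pm h)) (y A)))
  • asci (pm (J1 D (y B))) (pm h) (y A).

Definition kunit2 (A B : K) (h : PM (free_alg D A) (free_alg D B)) :
    J1 D (y B) ∘ pm h ⇒ J1 D (pm h) ∘ J1 D (y A) :=
  lan_desc (free_lan (pm_comp (J1 D (y B)) h)) (kunit2_restr h).

Lemma kunit2E (A B : K) (h : PM (free_alg D A) (free_alg D B)) :
  (J1 D (pm h) ◁ lam A) • kunit2 h = Jcell D (pm h) • (lam B ▷ pm h).
Proof.
apply: (free_ext (l := pm_comp (J1 D (y B)) h)).
have := lan_descE (free_lan (pm_comp (J1 D (y B)) h)) (kunit2_restr h).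
rewrite -/(kunit2 h) vcomp1r rwM => ->.
transitivity (asc (pm (J1 D (pm h))) (y (D0 D A)) (y A)
  • (((J1 D (pm h) ◁ (lam A ▷ y A • Jcell D (y A)))
      • sq_at (Jcell D (pm h) • (lam B ▷ pm h)) (y A))
     • asci (pm (J1 D (y B))) (pm h) (y A))); first by rewrite /kunit2_restr; nf; fin.
by rewrite lamE hcomp_id vcomp1l -whisker_sq_at.
Qed.

Lemma kunit2_unique (A B : K) (h : PM (free_alg D A) (free_alg D B))
    (u : J1 D (y B) ∘ pm h ⇒ J1 D (pm h) ∘ J1 D (y A)) :
  (J1 D (pm h) ◁ lam A) • u = Jcell D (pm h) • (lam B ▷ pm h) -> u = kunit2 h.
Proof.
move=> E; apply: (lam_ext (p := pm_comp (J1 D (y B)) h)).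
by rewrite E kunit2E.
Qed.

Lemma kunit2_sq (A B : K) (h : PM (free_alg D A) (free_alg D B)) (Z : K) (w : hom Z (D0 D A)) :
  (J1 D (pm h) ◁ (lam A ▷ w)) • sq_at (kunit2 h) w = η (pm h) w • (lam B ▷ (pm h ∘ w)).
Proof.
transitivity (sq_at ((J1 D (pm h) ◁ lam A) • kunit2 h) w); first by_components.
by rewrite kunit2E; by_components.
Qed.

(** The three laws of a colax transformation: after cancelling [lam] they are the equations that
    define [J2], [Jiot] and [Jgam]. *)
Lemma kunit2_nat (A B : K) (h h' : PM (free_alg D A) (free_alg D B)) (s : pm h ⇒ pm h') :
  (J2 D s ▷ J1 D (y A)) • kunit2 h = kunit2 h' • (J1 D (y B) ◁ s).
Proof.
apply: (lam_ext (p := pm_comp (J1 D (y B)) h)).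
rewrite vcompA -interchange -vcompA kunit2E vcompA J2E.
by rewrite (vcompA _ (kunit2 h')) kunit2E -!vcompA interchange.
Qed.

Lemma kunit2_id (A : K) :
  (Jiot D (D0 D A) ▷ J1 D (y A)) • kunit2 (pm_id (free_alg D A))
  = luni (pm (J1 D (y A))) • run (pm (J1 D (y A))).
Proof.
apply: (lam_ext (p := pm_comp (J1 D (y A)) (pm_id (free_alg D A)))).
rewrite vcompA -interchange -vcompA (kunit2E (pm_id (free_alg D A))) vcompA JiotE /Jiot_restr.
by nf; fin.
Qed.

Lemma kunit2_comp (A B C : K) (g : PM (free_alg D B) (free_alg D C))
    (f : PM (free_alg D A) (free_alg D B)) :
  (Jgam D (pm g) (pm f) ▷ J1 D (y A)) • kunit2 (pm_comp g f)
  = asc (pm (J1 D (pm g))) (J1 D (pm f)) (J1 D (y A)) • (J1 D (pm g) ◁ kunit2 f)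
    • asci (pm (J1 D (pm g))) (J1 D (y B)) (pm f) • (kunit2 g ▷ pm f)
    • asc (pm (J1 D (y C))) (pm g) (pm f).
Proof.
apply: (lam_ext (p := pm_comp (J1 D (y C)) (pm_comp g f))).
rewrite vcompA -interchange -[LHS]vcompA (kunit2E (pm_comp g f)) vcompA JgamE /Jgam_restr.
transitivity (asc (pm (J1 D (pm g))) (J1 D (pm f)) (y (D0 D A))
  • (J1 D (pm g) ◁ (J1 D (pm f) ◁ lam A • kunit2 f)
    • (asci (pm (J1 D (pm g))) (J1 D (y B)) (pm f) • (kunit2 g ▷ pm f
    • asc (pm (J1 D (y C))) (pm g) (pm f))))); last by nf; fin.
rewrite kunit2E.
transitivity (asc (pm (J1 D (pm g))) (J1 D (pm f)) (y (D0 D A))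
  • (J1 D (pm g) ◁ Jcell D (pm f)
    • (asci (pm (J1 D (pm g))) (y (D0 D B)) (pm f) • ((J1 D (pm g) ◁ lam B • kunit2 g) ▷ pm f
    • asc (pm (J1 D (y C))) (pm g) (pm f))))); last by nf; fin.
by rewrite kunit2E; nf; fin.
Qed.

(** On the 1-cells [Jf] the colax unit is the image under [J] of the unit [y].  This is how the
    naturality of [Psi] in [f : A -> B], for the biadjunction, becomes a case of its naturality
    in all pseudomorphisms. *)
Lemma kunit2_J (A B : K) (f : hom A B) : J_sq (Jcell D f) = kunit2 (J1 D f).
Proof.
apply: kunit2_unique; apply: (free_ext_sq (g := J1 D (y B)) (f := J1 D f)) => Z z.
apply: (iso_cancelr (c := (J1 D (y B) ◁ η f z) • η (y B) (f ∘ z))).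
  apply: is_iso_comp; last by apply: sq_at_iso; exact: Dcell_iso.
  by apply: is_iso_lw; apply: sq_at_iso; exact: Dcell_iso.
have -> : sq_at (J1 D (J1 D f) ◁ lam A • J_sq (Jcell D f)) (y A ∘ z)
  = J1 D (J1 D f) ◁ (lam A ▷ (y A ∘ z)) • sq_at (J_sq (Jcell D f)) (y A ∘ z) by by_components.
have -> : sq_at (Jcell D (J1 D f) • lam B ▷ J1 D f) (y A ∘ z)
  = η (J1 D f) (y A ∘ z) • lam B ▷ (J1 D f ∘ (y A ∘ z)) by by_components.
assoc_right; rewrite J_sqE lwMA lam_eta hcomp_id vcomp1l.
by rewrite (vcomp_pre _ (interchange _ _)); assoc_right; rewrite lam_eta vcomp1r.
Qed.

End Free.
Arguments free_lan {K D A C} l.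
Arguments kunit2 {K D A B} h.

(** * The counit data of an adjunction with unit [y] *)

Section Counit.
Variables (K : TwoCat) (D : LeftKanPseudomonad K).
Notation y := (Dy D).
Notation PM := (PseudoMorphism (D := D)).
Notation η f z := (sq_at (Jcell D f) z).

(** What an adjunction between free and forgetful has besides its unit [y].  The axioms are the
    naturality of [Phi] and the first triangle identity; with the invertibility of [Phi] they
    imply all the others, as they determine [fc2] and [fcPsi] from [fcPhi]. *)
Record FreeCounit := {
  fc1 :> forall C : PseudoAlgebra D, PM (free_alg D C) C;
  fc2 : forall (C X : PseudoAlgebra D) (h : PM C X),
    pm (fc1 X) ∘ J1 D h ⇒ pm h ∘ pm (fc1 C);
  fcPhi : forall C : PseudoAlgebra D, id1 (carrier C) ⇒ pm (fc1 C) ∘ y C;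
  fcPsi : forall A : K, pm (fc1 (free_alg D A)) ∘ J1 D (y A) ⇒ id1 (D0 D A);
  fcPhi_iso : forall C : PseudoAlgebra D, is_iso (fcPhi C);
  fcPhi_nat : forall (C X : PseudoAlgebra D) (h : PM C X),
    asci (pm h) (pm (fc1 C)) (y C) • (fc2 h ▷ y C) • asc (pm (fc1 X)) (J1 D h) (y C)
    • (pm (fc1 X) ◁ Jcell D h) • asci (pm (fc1 X)) (y X) (pm h) • (fcPhi X ▷ pm h)
    = (pm h ◁ fcPhi C) • (runi (pm h) • lun (pm h));
  fcPsi_triangle : forall A : K,
    lun (y A) • (fcPsi A ▷ y A) • asc (pm (fc1 (free_alg D A))) (J1 D (y A)) (y A)
    • (pm (fc1 (free_alg D A)) ◁ Jcell D (y A))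
    • asci (pm (fc1 (free_alg D A))) (y (D0 D A)) (y A)
    • (fcPhi (free_alg D A) ▷ y A) • luni (y A)
    = id2 (y A)
}.

Variable e : FreeCounit.
Notation Φ := (fcPhi e).
Notation Ψ := (fcPsi e).

(** The composite [h z => e_X y h z => e_X Jh y z].  Being invertible, it is cancelled on the right
    to prove equations between 2-cells out of [e_X Jh]. *)
Notation κ h z := ((pm (fc1 e _) ◁ η h z) • unit_at (fcPhi e _) (h ∘ z)).

Lemma fc2E (C X : PseudoAlgebra D) (h : PM C X) (Z : K) (z : hom Z C) :
  sq_at (fc2 e h) (y C ∘ z) • κ (pm h) z = pm h ◁ unit_at (Φ C) z.
Proof.
transitivity (asci (pm h) (pm (e C)) (y C ∘ z) • (asci (pm h ∘ pm (e C)) (y C) z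
  • ((asc (pm h) (pm (e C)) (y C) ▷ z
      • ((pm h ◁ Φ C • (runi (pm h) • lun (pm h))) ▷ z)) • (luni (pm h) ▷ z))));
  last by_components.
by rewrite -fcPhi_nat; by_components.
Qed.

Lemma fcPsiE (A : K) (Z : K) (z : hom Z A) :
  counit_at (Ψ A) (y A ∘ z)
  • ((pm (e (free_alg D A)) ◁ η (y A) z) • unit_at (Φ (free_alg D A)) (y A ∘ z))
  = id2 (y A ∘ z).
Proof. by rewrite -hcomp_id -(fcPsi_triangle e); by_components. Qed.

Lemma kappa_iso (A : K) (X : PseudoAlgebra D) (h : hom A X) (Z : K) (z : hom Z A) :
  is_iso (κ h z).
Proof.
apply: is_iso_comp; last by apply: unit_at_iso; exact: fcPhi_iso.
by apply: is_iso_lw; apply: sq_at_iso; exact: Dcell_iso.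
Qed.

(** The laws of a colax transformation: composed with [κ] they reduce, by [fc2E], to the
    laws of the unit [y] and the naturality of [Φ] in [z]. *)
Lemma fc2_nat (C X : PseudoAlgebra D) (h h' : PM C X) (s : pm h ⇒ pm h') :
  (s ▷ pm (e C)) • fc2 e h = fc2 e h' • (pm (e X) ◁ J2 D s).
Proof.
apply: (free_ext_sq (g := e X) (f := J1 D h)) => Z z; apply: (iso_cancelr (kappa_iso _ _)).
have -> : sq_at ((s ▷ pm (e C)) • fc2 e h) (y C ∘ z)
  = s ▷ (pm (e C) ∘ (y C ∘ z)) • sq_at (fc2 e h) (y C ∘ z) by by_components.
have -> : sq_at (fc2 e h' • (pm (e X) ◁ J2 D s)) (y C ∘ z)
  = sq_at (fc2 e h') (y C ∘ z) • (pm (e X) ◁ (J2 D s ▷ (y C ∘ z))) by by_components.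
assoc_right; rewrite fc2E interchange -fc2E lwMA eta_nat lwM; assoc_right.
by rewrite -(unit_at_nat (Φ X)).
Qed.

Lemma fc2_id (C : PseudoAlgebra D) :
  fc2 e (pm_id C) = luni (pm (e C)) • run (pm (e C)) • (pm (e C) ◁ Jiot D C).
Proof.
apply: (free_ext_sq (g := e C) (f := J1 D (pm_id C))) => Z z.
apply: (iso_cancelr (kappa_iso _ _)); rewrite fc2E.
transitivity (luni (e C ∘ (y C ∘ z)) • (e C ◁
  (lun (y C ∘ z) • (Jiot D C ▷ (y C ∘ z) • η (id1 (carrier C)) z))
  • unit_at (Φ C) (id1 (carrier C) ∘ z)));
  last by_components.
rewrite iot_eta -(unit_at_nat (Φ C)).
by nf.
Qed.

Lemma fc2_comp (C X Z : PseudoAlgebra D) (g : PM X Z) (f : PM C X) :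
  fc2 e (pm_comp g f)
  = asc (pm g) (pm f) (pm (e C)) • (pm g ◁ fc2 e f) • asci (pm g) (pm (e X)) (pm (J1 D f))
    • (fc2 e g ▷ pm (J1 D f)) • asc (pm (e Z)) (pm (J1 D g)) (pm (J1 D f))
    • (pm (e Z) ◁ Jgam D (pm g) (pm f)).
Proof.
apply: (free_ext_sq (g := e Z) (f := J1 D (pm_comp g f))) => W z.
apply: (iso_cancelr (kappa_iso _ _)); rewrite fc2E.
transitivity (asc (pm g) (pm f) (e C ∘ (y C ∘ z)) • (pm g ◁ sq_at (fc2 e f) (y C ∘ z) •
  (sq_at (fc2 e g) (J1 D f ∘ (y C ∘ z))
  • (e Z ◁ (split_at (Jgam D g f) (y C ∘ z) • η (pm g ∘ pm f) z)
  • unit_at (Φ Z) ((pm g ∘ pm f) ∘ z))))); last by_components.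
rewrite split_at_gam lwM; assoc_right; rewrite lwM; assoc_right; rewrite -(unit_at_nat (Φ Z)).
rewrite (vcomp_pre _ (sq_at_nat _ _)); assoc_right; rewrite lwMA.
rewrite (vcomp_pre3 _ (fc2E g (pm f ∘ z))) lwMA -vcompA fc2E.
exact: lw_comp.
Qed.

(** * Naturality and triangle identities *)

(** Restricted along [y] and composed with [κ y], both sides become [Φ y]: the left side by the
    first triangle, the right side because [lam] is inverse to the naturality cell in [κ y]. *)
Lemma Phi_Psi (B : K) :
  Φ (free_alg D B) • Ψ B = pm (e (free_alg D B)) ◁ lam D B.
Proof.
apply: (free_ext_sq (g := e (free_alg D B)) (f := J1 D (y B))) => Z z.
apply: (iso_cancelr (kappa_iso (X := free_alg D B) (y B) z)).
have -> : sq_at (Φ (free_alg D B) • Ψ B) (y B ∘ z)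
  = unit_at (Φ (free_alg D B)) (y B ∘ z) • counit_at (Ψ B) (y B ∘ z) by by_components.
have -> : sq_at (pm (e (free_alg D B)) ◁ lam D B) (y B ∘ z)
  = pm (e (free_alg D B)) ◁ (lam D B ▷ (y B ∘ z)) by by_components.
assoc_right; rewrite fcPsiE lwMA lam_eta hcomp_id vcomp1l vcomp1r.
by [].
Qed.

Lemma Phi_Psi_at (B : K) (Z : K) (w : hom Z (D0 D B)) :
  unit_at (Φ (free_alg D B)) w • counit_at (Ψ B) w = pm (e (free_alg D B)) ◁ (lam D B ▷ w).
Proof.
transitivity (sq_at (Φ (free_alg D B) • Ψ B) w); first by_components.
by rewrite Phi_Psi; by_components.
Qed.

(** Composing with the invertible [h Φ] turns [Ψ] into [e lam] on both sides, by [Phi_Psi], and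
    then [lam] turns the colax unit into [y].  What remains is the naturality
    of [Φ] at [h], which holds for every pseudomorphism. *)
Lemma Psi_mod_at (A B : K) (h : PM (free_alg D A) (free_alg D B)) (Z : K) (w : hom Z (D0 D A)) :
  counit_at (Ψ B) (pm h ∘ w)
  = pm h ◁ counit_at (Ψ A) w • (sq_at (fc2 e h) (J1 D (y A) ∘ w)
     • (pm (e (free_alg D B)) ◁ sq_at (kunit2 h) w)).
Proof.
apply: (iso_cancel (c := pm h ◁ unit_at (Φ (free_alg D A)) w)).
  by apply: is_iso_lw; apply: unit_at_iso; exact: fcPhi_iso.
rewrite lwMA Phi_Psi_at (vcomp_pre _ (eq_sym (sq_at_nat _ _))); assoc_right.
rewrite -lwM kunit2_sq -fc2E; assoc_right.
by rewrite Phi_Psi_at -lwM.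
Qed.

Lemma Psi_mod (A B : K) (h : PM (free_alg D A) (free_alg D B)) :
  (runi (pm h) • lun (pm h)) • (Ψ B ▷ pm h)
  = (pm h ◁ Ψ A)
    • (asci (pm h) (pm (e (free_alg D A))) (J1 D (y A))
       • (fc2 e h ▷ pm (J1 D (y A)))
       • asc (pm (e (free_alg D B))) (J1 D (pm h)) (J1 D (y A))
       • (pm (e (free_alg D B)) ◁ kunit2 h)
       • asci (pm (e (free_alg D B))) (J1 D (y B)) (pm h)).
Proof.
apply: comp_ext => Z w.
transitivity (asc (pm h) (id1 _) w • (pm h ◁ luni w
   • (counit_at (Ψ B) (pm h ∘ w) • (asci _ _ _ • asci _ _ _)))); first by_components.
by rewrite Psi_mod_at; by_components.
Qed.

(** Restricted along [y] and composed with [Φ], this is the naturality of [Φ] at the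
    pseudomorphism [e C], followed by [e] applied to the first triangle. *)
Lemma counit_triangle_at (C : PseudoAlgebra D) (Z : K) (z : hom Z C) :
  pm (e C) ◁ counit_at (Ψ C) (y C ∘ z) • (sq_at (fc2 e (e C)) (J1 D (y C) ∘ (y C ∘ z))
   • (pm (e C) ◁ unit_at (J_unit D (Φ C)) (y C ∘ z))) = id2 (e C ∘ (y C ∘ z)).
Proof.
apply: (iso_cancelr (c := unit_at (Φ C) z)); first by apply: unit_at_iso; exact: fcPhi_iso.
rewrite J_unitE !lwM; assoc_right.
rewrite -(unit_at_nat (Φ C)) (vcomp_pre _ (sq_at_nat _ _)); assoc_right.
rewrite (vcomp_pre3 _ (fc2E (e C) (y C ∘ z))) !lwMA -(vcompA (counit_at _ _)) fcPsiE hcomp_id.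
by [].
Qed.

Lemma counit_triangle (C : PseudoAlgebra D) :
  run (pm (e C)) • (pm (e C) ◁ Ψ C)
  • asci (pm (e C)) (pm (e (free_alg D C))) (pm (J1 D (y C)))
  • (fc2 e (e C) ▷ pm (J1 D (y C)))
  • asc (pm (e C)) (pm (J1 D (e C))) (pm (J1 D (y C)))
  • (pm (e C) ◁ J_unit D (Φ C)) • runi (pm (e C)) = id2 (pm (e C)).
Proof.
apply: (free_ext_comp (l := e C)) => Z z; rewrite hcomp_id -counit_triangle_at.
by_components.
Qed.

(** The unit of the adjunction in which [e C] is left adjoint to [y C], with counit the inverse of
    [Φ C], as always for a lax idempotent structure. *)
Definition tau (C : PseudoAlgebra D) : id1 (D0 D C) ⇒ y C ∘ pm (e C) :=
  lan_desc (Dy_lan D C) (asc (y C) (pm (e C)) (y C) • ((y C ◁ Φ C) • runi (y C))).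

Lemma tauE (C : PseudoAlgebra D) (Z : K) (z : hom Z C) :
  unit_at (tau C) (y C ∘ z) = y C ◁ unit_at (Φ C) z.
Proof.
transitivity (asci _ _ _ • (asci _ _ _ • (tau C ▷ y C • luni (y C)) ▷ z)); first by_components.
by rewrite lan_descE; by_components.
Qed.

(** Restricted along [y], both sides are [y Φ] followed by the naturality cell of [y] at [e C]: on
    the left, [lam] cancels the other naturality cell of [J_unitE]. *)
Lemma lam_J_unit (C : PseudoAlgebra D) :
  (pm (J1 D (pm (e C))) ◁ lam D C) • J_unit D (Φ C) = Jcell D (pm (e C)) • tau C.
Proof.
apply: (free_ext_comp (l := pm_id (free_alg D C))) => Z z.
apply: (iso_cancelr (c := luni (y C ∘ z))); first exact: is_iso_eqcell.
apply: (iso_cancel (c := asci (pm (J1 D (pm (e C)))) (y (D0 D C)) (y C ∘ z))).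
  exact: is_iso_eqcell.
transitivity (pm (J1 D (pm (e C))) ◁ (lam D C ▷ (y C ∘ z)) • unit_at (J_unit D (Φ C)) (y C ∘ z)).
  by_components.
rewrite J_unitE lwMA lam_eta hcomp_id vcomp1l -tauE.
by_components.
Qed.

Lemma lam_J_unit_at (C : PseudoAlgebra D) (Z : K) (w : hom Z (D0 D C)) :
  (pm (J1 D (pm (e C))) ◁ (lam D C ▷ w)) • unit_at (J_unit D (Φ C)) w
  = η (pm (e C)) w • unit_at (tau C) w.
Proof.
transitivity (unit_at ((pm (J1 D (pm (e C))) ◁ lam D C) • J_unit D (Φ C)) w); first by_components.
by rewrite lam_J_unit; by_components.
Qed.

(** Restricted along [y], this is [y] applied to the naturality of [Φ] at [h]. *)
Lemma tau_J (C X : PseudoAlgebra D) (h : PM C X) (Z : K) (z : hom Z C) :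
  η (pm h) (pm (e C) ∘ (y C ∘ z))
  • ((y X ◁ sq_at (fc2 e h) (y C ∘ z)) • unit_at (tau X) (pm (J1 D (pm h)) ∘ (y C ∘ z)))
  = pm (J1 D (pm h)) ◁ unit_at (tau C) (y C ∘ z).
Proof.
apply: (iso_cancelr (c := η (pm h) z)); first by apply: sq_at_iso; exact: Dcell_iso.
rewrite tauE -(sq_at_nat (Jcell D h)); assoc_right.
rewrite (unit_at_nat (tau X) (η h z)) tauE -!lwM fc2E.
by [].
Qed.

(** Cancelling [lam] replaces the colax unit by [y] and [J Φ] by [tau]; by the naturality of [y]
    with respect to [fc2 e h], what remains is [tau_J]. *)
Lemma J_Phi_mod_at (C X : PseudoAlgebra D) (h : PM C X) (Z : K) (z : hom Z C) :
  sq_at (J_sq D (fc2 e h)) (J1 D (y C) ∘ (y C ∘ z))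
  • ((pm (J1 D (pm (e X))) ◁ sq_at (kunit2 (J1 D (pm h))) (y C ∘ z))
     • unit_at (J_unit D (Φ X)) (pm (J1 D (pm h)) ∘ (y C ∘ z)))
  = pm (J1 D (pm h)) ◁ unit_at (J_unit D (Φ C)) (y C ∘ z).
Proof.
apply: (iso_cancel (c := pm (J1 D (pm h)) ◁ (pm (J1 D (pm (e C))) ◁ (lam D C ▷ (y C ∘ z))))).
  by do 2!apply: is_iso_lw; exact: lam_comp_iso.
rewrite (vcomp_pre _ (eq_sym (sq_at_nat _ _))); assoc_right.
rewrite lwMA kunit2_sq lwM; assoc_right.
rewrite lam_J_unit_at (vcomp_pre3 _ (J_sqE _ _ _)); assoc_right.
by rewrite tau_J -!lwM lam_J_unit_at.
Qed.

Lemma J_Phi_mod (C X : PseudoAlgebra D) (h : PM C X) :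
  asci (pm (J1 D (pm h))) (J1 D (pm (e C))) (J1 D (y C))
  • (J_sq D (fc2 e h) ▷ pm (J1 D (y C)))
  • asc (pm (J1 D (pm (e X)))) (J1 D (J1 D (pm h))) (J1 D (y C))
  • (pm (J1 D (pm (e X))) ◁ kunit2 (J1 D (pm h)))
  • asci (pm (J1 D (pm (e X)))) (J1 D (y X)) (J1 D (pm h))
  • (J_unit D (Φ X) ▷ pm (J1 D (pm h)))
  = (pm (J1 D (pm h)) ◁ J_unit D (Φ C)) • (runi (pm (J1 D (pm h))) • lun (pm (J1 D (pm h)))).
Proof.
apply: (free_ext_comp (l := pm_comp (pm_id (free_alg D X)) (J1 D (pm h)))) => Z z.
transitivity (asc (pm (J1 D (pm h))) (pm (J1 D (pm (e C))) ∘ pm (J1 D (y C))) (y C ∘ z)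
  • (pm (J1 D (pm h)) ◁ asc (pm (J1 D (pm (e C)))) (pm (J1 D (y C))) (y C ∘ z)
     • ((sq_at (J_sq D (fc2 e h)) (J1 D (y C) ∘ (y C ∘ z))
       • ((pm (J1 D (pm (e X))) ◁ sq_at (kunit2 (J1 D (pm h))) (y C ∘ z))
          • unit_at (J_unit D (Φ X)) (pm (J1 D (pm h)) ∘ (y C ∘ z))))
     • (lun _ • asci (id1 _) (J1 D (pm h)) (y C ∘ z))))); first by_components.
by rewrite J_Phi_mod_at; by_components.
Qed.

(** Restricted along [y], this is [y] applied to the first triangle. *)
Lemma tau_lam (A : K) (Z : K) (z : hom Z A) :
  (y (D0 D A) ◁ counit_at (Ψ A) (y A ∘ z))
  • unit_at (tau (free_alg D A)) (pm (J1 D (y A)) ∘ (y A ∘ z)) = lam D A ▷ (y A ∘ z).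
Proof.
apply: (iso_cancelr (c := η (y A) z)); first by apply: sq_at_iso; exact: Dcell_iso.
assoc_right; rewrite (unit_at_nat (tau (free_alg D A)) (η (y A) z)).
rewrite (tauE (C := free_alg D A) (y A ∘ z)).
by rewrite -!lwM fcPsiE hcomp_id lam_eta.
Qed.

(** Cancelling [lam] on the left reduces the composite to that of [tau_lam]. *)
Lemma J_unit_triangle_at (A : K) (Z : K) (z : hom Z A) :
  counit_at (J_counit D (Ψ A)) (pm (J1 D (y A)) ∘ (y A ∘ z))
  • ((pm (J1 D (pm (e (free_alg D A)))) ◁ sq_at (kunit2 (J1 D (y A))) (y A ∘ z))
     • unit_at (J_unit D (Φ (free_alg D A))) (pm (J1 D (y A)) ∘ (y A ∘ z)))
  = id2 (pm (J1 D (y A)) ∘ (y A ∘ z)).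
Proof.
apply: (iso_cancel (lam_comp_iso D z)).
rewrite (vcomp_pre _ (eq_sym (counit_at_nat _ _))); assoc_right.
rewrite lwMA kunit2_sq lwM; assoc_right; rewrite (lam_J_unit_at (C := free_alg D A)).
rewrite (vcomp_pre3 _ (J_counitE _ _ _)) tau_lam vcomp1r.
by [].
Qed.

Lemma J_unit_triangle (A : K) :
  lun (pm (J1 D (y A)))
  • (J_counit D (Ψ A) ▷ pm (J1 D (y A)))
  • asc (pm (J1 D (pm (e (free_alg D A))))) (J1 D (J1 D (y A))) (J1 D (y A))
  • (pm (J1 D (pm (e (free_alg D A)))) ◁ kunit2 (J1 D (y A)))
  • asci (pm (J1 D (pm (e (free_alg D A))))) (J1 D (y (D0 D A))) (J1 D (y A))
  • (J_unit D (Φ (free_alg D A)) ▷ pm (J1 D (y A)))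
  • luni (pm (J1 D (y A))) = id2 (pm (J1 D (y A))).
Proof.
apply: (free_ext_comp (l := J1 D (y A))) => Z z; rewrite hcomp_id -J_unit_triangle_at.
by_components.
Qed.
End Counit.

(** * The free-forgetful biadjunction *)

(** A coherence cell of the 2-category of algebras comes from an equality of pseudomorphisms, not
    of their underlying 1-cells, so it is equal but not convertible to the one of [K]. *)
Section Coherence.
Variables (K : TwoCat) (D : LeftKanPseudomonad K).

Lemma PsAlg_asc (A B C E : PsAlg D) (h : hom C E) (g : hom B C) (f : hom A B) :
  asc h g f = asc (K := K) (pm h) (pm g) (pm f).
Proof. exact: PsAlg_eqcell. Qed.
Lemma PsAlg_asci (A B C E : PsAlg D) (h : hom C E) (g : hom B C) (f : hom A B) :
  asci h g f = asci (K := K) (pm h) (pm g) (pm f).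
Proof. exact: PsAlg_eqcell. Qed.
Lemma PsAlg_lun (A B : PsAlg D) (f : hom A B) : lun f = lun (K := K) (pm f).
Proof. exact: PsAlg_eqcell. Qed.
Lemma PsAlg_luni (A B : PsAlg D) (f : hom A B) : luni f = luni (K := K) (pm f).
Proof. exact: PsAlg_eqcell. Qed.
Lemma PsAlg_run (A B : PsAlg D) (f : hom A B) : run f = run (K := K) (pm f).
Proof. exact: PsAlg_eqcell. Qed.
Lemma PsAlg_runi (A B : PsAlg D) (f : hom A B) : runi f = runi (K := K) (pm f).
Proof. exact: PsAlg_eqcell. Qed.

Lemma Kleisli_asc (A B C E : Kleisli D) (h : hom C E) (g : hom B C) (f : hom A B) :
  asc h g f = asc (K := K) (pm h) (pm g) (pm f).
Proof. exact: PsAlg_eqcell. Qed.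
Lemma Kleisli_asci (A B C E : Kleisli D) (h : hom C E) (g : hom B C) (f : hom A B) :
  asci h g f = asci (K := K) (pm h) (pm g) (pm f).
Proof. exact: PsAlg_eqcell. Qed.
Lemma Kleisli_lun (A B : Kleisli D) (f : hom A B) : lun f = lun (K := K) (pm f).
Proof. exact: PsAlg_eqcell. Qed.
Lemma Kleisli_luni (A B : Kleisli D) (f : hom A B) : luni f = luni (K := K) (pm f).
Proof. exact: PsAlg_eqcell. Qed.
Lemma Kleisli_run (A B : Kleisli D) (f : hom A B) : run f = run (K := K) (pm f).
Proof. exact: PsAlg_eqcell. Qed.
Lemma Kleisli_runi (A B : Kleisli D) (f : hom A B) : runi f = runi (K := K) (pm f).
Proof. exact: PsAlg_eqcell. Qed.
End Coherence.

Ltac toK := rewrite -> ?PsAlg_asc, ?PsAlg_asci, ?PsAlg_lun, ?PsAlg_luni, ?PsAlg_run, ?PsAlg_runi,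
  ?Kleisli_asc, ?Kleisli_asci, ?Kleisli_lun, ?Kleisli_luni, ?Kleisli_run, ?Kleisli_runi.

Section Canonical.
Variables (K : TwoCat) (D : LeftKanPseudomonad K).
Notation y := (Dy D).
Notation PM := (PseudoMorphism (D := D)).

Definition can_eps1 (C : PseudoAlgebra D) : PM (free_alg D C) C :=
  @Build_PseudoMorphism K D (free_alg D C) C (aext C (id1 (carrier C)))
    (fun B f => @aext_preserves K D C _ _ (id1 (carrier C)) f).
Notation e := can_eps1.
Definition can_Phi (C : PseudoAlgebra D) : id1 (carrier C) ⇒ pm (e C) ∘ y C :=
  acell C (id1 (carrier C)).

(** [h => e_X Jh y], invertible since [Φ] and the structure cell of [Jh] are.  Thus [e_X Jh] is a
    left Kan extension of [h] along [y]. *)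
Definition can_kappa (A : K) (X : PseudoAlgebra D) (h : hom A X) :
    h ⇒ (pm (e X) ∘ J1 D h) ∘ y A :=
  asc (pm (e X)) (J1 D h) (y A) • ((pm (e X) ◁ Jcell D h)
  • (asci (pm (e X)) (y X) h • (can_Phi X ▷ h • luni h))).

Lemma can_kappa_lan (A : K) (X : PseudoAlgebra D) (h : hom A X) : IsLan (can_kappa h).
Proof.
apply: (free_lan_iso (l := pm_comp (e X) (J1 D h))).
apply: is_iso_comp; first exact: is_iso_eqcell.
apply: is_iso_comp; first by apply: is_iso_lw; exact: Dcell_iso.
apply: is_iso_comp; first exact: is_iso_eqcell.
by apply: is_iso_comp; [apply: is_iso_rw; exact: acell_iso | exact: is_iso_eqcell].
Qed.

Arguments can_kappa_lan {A X} h.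

(** [h => h e_C y], the value that the naturality of [Φ] prescribes for the restriction of [e_h]
    along [can_kappa h]. *)
Definition can_target (C X : PseudoAlgebra D) (h : PM C X) : pm h ⇒ (pm h ∘ pm (e C)) ∘ y C :=
  asc (pm h) (pm (e C)) (y C) • ((pm h ◁ can_Phi C) • runi (pm h)).

Lemma can_target_lan (C X : PseudoAlgebra D) (h : PM C X) : IsLan (can_target h).
Proof.
apply: (free_lan_iso (l := pm_comp h (e C))).
apply: is_iso_comp; first exact: is_iso_eqcell.
by apply: is_iso_comp; [apply: is_iso_lw; exact: acell_iso | exact: is_iso_eqcell].
Qed.

Arguments can_target_lan {C X} h.

Definition can_eps2 (C X : PseudoAlgebra D) (h : PM C X) :
  pm (e X) ∘ J1 D h ⇒ pm h ∘ pm (e C) := lan_desc (can_kappa_lan (pm h)) (can_target h).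
Definition can_Psi (A : K) : pm (e (free_alg D A)) ∘ J1 D (y A) ⇒ id1 (D0 D A) :=
  lan_desc (can_kappa_lan (X := free_alg D A) (y A)) (luni (y A)).

Lemma can_Phi_nat (C X : PseudoAlgebra D) (h : PM C X) :
  asci (pm h) (pm (e C)) (y C) • (can_eps2 h ▷ y C) • asc (pm (e X)) (J1 D h) (y C)
  • (pm (e X) ◁ Jcell D h) • asci (pm (e X)) (y X) (pm h) • (can_Phi X ▷ pm h)
  = (pm h ◁ can_Phi C) • (runi (pm h) • lun (pm h)).
Proof.
transitivity (asci (pm h) (pm (e C)) (y C) • ((can_eps2 h ▷ y C • can_kappa (pm h)) • lun (pm h))).
  by rewrite /can_kappa; nf; fin.
by rewrite lan_descE /can_target; nf; fin.
Qed.

Lemma can_Psi_triangle (A : K) :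
  lun (y A) • (can_Psi A ▷ y A) • asc (pm (e (free_alg D A))) (J1 D (y A)) (y A)
  • (pm (e (free_alg D A)) ◁ Jcell D (y A))
  • asci (pm (e (free_alg D A))) (y (D0 D A)) (y A)
  • (can_Phi (free_alg D A) ▷ y A) • luni (y A)
  = id2 (y A).
Proof.
transitivity (lun (y A) • (can_Psi A ▷ y A • can_kappa (X := free_alg D A) (y A))).
  by rewrite /can_kappa; nf; fin.
by rewrite lan_descE; nf; fin.
Qed.

Definition can_counit : FreeCounit D := {|
  fc1 := can_eps1; fc2 := can_eps2; fcPhi := can_Phi; fcPsi := can_Psi;
  fcPhi_iso := fun C => @acell_iso K D C _ (id1 (carrier C));
  fcPhi_nat := can_Phi_nat; fcPsi_triangle := can_Psi_triangle |}.

(** A 2-cell that compares two left Kan extensions of the same 1-cell is invertible; the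
    extensions are those of [h], and of [y A] in the next lemma. *)
Lemma can_eps2_iso (C X : PseudoAlgebra D) (h : PM C X) : is_iso (can_eps2 h).
Proof. apply: (lan_iso (can_kappa_lan _) (can_target_lan h)); exact: lan_descE. Qed.
Lemma can_Psi_iso (A : K) : is_iso (can_Psi A).
Proof.
by apply: (lan_iso (can_kappa_lan (X := free_alg D A) (y A)) (Dy_lan D A)); exact: lan_descE.
Qed.

End Canonical.

Section FreeAdjunction.
Variables (K : TwoCat) (D : LeftKanPseudomonad K).
Notation y := (Dy D).
Notation PM := (PseudoMorphism (D := D)).

Lemma y_laws : ColaxLaws (pf_id K) (pf_comp (forgetful D) (free D)) (y_data D).
Proof.
split=> /=.
- move=> A B f g s; exact (J2E D s).
- move=> A; rewrite !vcomp1l; refine (eq_trans (JiotE D A) _).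
  by rewrite /Jiot_restr; nf; fin.
- move=> A B C g f; rewrite !vcomp1l; refine (eq_trans (JgamE D g f) _).
  by rewrite /Jgam_restr; nf; fin.
Qed.

Variable e : FreeCounit D.

Definition counit_data : ColaxData (pf_comp (free D) (forgetful D)) (pf_id (PsAlg D)) :=
  Build_ColaxData (pf_comp (free D) (forgetful D)) (pf_id (PsAlg D))
    (fun C => e C) (fun C X h => fc2 e h).

Lemma counit_laws : ColaxLaws (pf_comp (free D) (forgetful D)) (pf_id (PsAlg D)) counit_data.
Proof.
split=> /=.
- move=> C X f g s; exact: fc2_nat.
- move=> C; toK; rewrite J2_id hcomp_id !vcomp1l vcomp1r.
  exact: fc2_id.
- move=> C X Z g f; toK; rewrite J2_id hcomp_id !vcomp1l vcomp1r.
  exact: fc2_comp.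
Qed.

Definition y_trans : ColaxTrans (pf_id K) (pf_comp (forgetful D) (free D)) :=
  Build_ColaxTrans y_laws.
Definition counit_trans : ColaxTrans (pf_comp (free D) (forgetful D)) (pf_id (PsAlg D)) :=
  Build_ColaxTrans counit_laws.

Definition free_Psi : Modification
  (cd_comp (cd_pre counit_trans (free D)) (cd_post (free D) y_trans)) (cd_id (free D)).
Proof.
refine (@Build_Modification _ _ _ _
  (cd_comp (cd_pre counit_trans (free D)) (cd_post (free D) y_trans)) (cd_id (free D))
  (fun A => fcPsi e A) _).
move=> A B f /=; toK; rewrite !vcomp1l !vcomp1r.
by refine (eq_trans (Psi_mod e (J1 D f)) _); rewrite -kunit2_J.
Defined.

Definition free_Phi : Modification
  (cd_id (forgetful D))
  (cd_comp (cd_post (forgetful D) counit_trans) (cd_pre y_trans (forgetful D))).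
Proof.
refine (@Build_Modification _ _ _ _ (cd_id (forgetful D))
  (cd_comp (cd_post (forgetful D) counit_trans) (cd_pre y_trans (forgetful D)))
  (fun C => fcPhi e C) _).
move=> C X h /=; toK; rewrite !vcomp1l !vcomp1r; exact: fcPhi_nat.
Defined.

Definition free_adjunction : ColaxAdjunction (free D) (forgetful D).
Proof.
refine (@Build_ColaxAdjunction K (PsAlg D) (free D) (forgetful D) y_trans counit_trans
  free_Psi free_Phi _ _).
- move=> A /=; toK; rewrite !vcomp1l !vcomp1r; exact: fcPsi_triangle.
- move=> C /=; toK; rewrite !vcomp1l !vcomp1r; exact: counit_triangle.
Defined.

Definition free_biadjunction
    (e2_iso : forall (C X : PseudoAlgebra D) (h : PM C X), is_iso (fc2 e h))
    (Psi_iso : forall A : K, is_iso (fcPsi e A)) : Biadjunction (free D) (forgetful D).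
Proof.
refine (@Build_Biadjunction K (PsAlg D) (free D) (forgetful D) free_adjunction _ _ _ _).
- move=> A B f; exact: Dcell_iso.
- exact: e2_iso.
- exact: Psi_iso.
- exact: fcPhi_iso.
Defined.

End FreeAdjunction.

Lemma free_counit_of (K : TwoCat) (D : LeftKanPseudomonad K)
    (A : ColaxAdjunction (free D) (forgetful D)) :
  ct_data (adj_unit A) = y_data D -> (forall C, is_iso (adj_Phi A C)) ->
  exists e : FreeCounit D, counit_data e = ct_data (adj_counit A).
Proof.
case: A => [[u u_laws] eps Psi Phi T1 T2] /= E; subst u => Phi_iso.
unshelve refine (ex_intro _ (@Build_FreeCounit K D (fun C => ct1 eps C)
  (fun C X h => ct2 eps h) (fun C => Phi C) (fun A => Psi A) Phi_iso _ _) _) => /=.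
- move=> C X h; have /= := mo_nat Phi h; toK; rewrite !vcomp1l !vcomp1r; exact.
- move=> A; have /= := T1 A; toK; rewrite !vcomp1l !vcomp1r; exact.
- by [].
Qed.

(** * The induced colax adjunction *)

Section Kleisli.
Variables (K : TwoCat) (D : LeftKanPseudomonad K).
Notation y := (Dy D).
Notation JU := (pf_comp (J D) (forgetful D)).

Definition kunit_data : ColaxData (pf_id (Kleisli D)) (pf_comp JU (Kleisli_incl D)) :=
  Build_ColaxData (pf_id (Kleisli D)) (pf_comp JU (Kleisli_incl D))
    (fun A => J1 D (y A)) (fun A B h => kunit2 h).

Lemma kunit_laws : ColaxLaws (pf_id (Kleisli D)) (pf_comp JU (Kleisli_incl D)) kunit_data.
Proof.
split=> /=.
- move=> A B f g s; exact: kunit2_nat.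
- move=> A; toK; rewrite !J2_id !vcomp1r hcomp_id vcomp1r.
  exact: kunit2_id.
- move=> A B C g f; toK; rewrite !J2_id !vcomp1r hcomp_id vcomp1r.
  exact: kunit2_comp.
Qed.

Definition kunit : ColaxTrans (pf_id (Kleisli D)) (pf_comp JU (Kleisli_incl D)) :=
  Build_ColaxTrans kunit_laws.

Variable e : FreeCounit D.

(** The data are those of the biadjunction; only the bracketing of the composite pseudofunctor,
    and so the form of its comparison cells, is different. *)
Lemma kcounit_laws :
  ColaxLaws (pf_comp (Kleisli_incl D) JU) (pf_id (PsAlg D)) (counit_data e).
Proof.
split=> /=.
- move=> C X f g s; exact: fc2_nat.
- move=> C; toK; rewrite J2_id hcomp_id !vcomp1l vcomp1r.
  exact: fc2_id.
- move=> C X Z g f; toK; rewrite J2_id hcomp_id !vcomp1l vcomp1r.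
  exact: fc2_comp.
Qed.

Definition kcounit : ColaxTrans (pf_comp (Kleisli_incl D) JU) (pf_id (PsAlg D)) :=
  Build_ColaxTrans kcounit_laws.

Definition kPsi : Modification
  (cd_comp (cd_pre kcounit (Kleisli_incl D)) (cd_post (Kleisli_incl D) kunit))
  (cd_id (Kleisli_incl D)).
Proof.
refine (@Build_Modification _ _ _ _
  (cd_comp (cd_pre kcounit (Kleisli_incl D)) (cd_post (Kleisli_incl D) kunit))
  (cd_id (Kleisli_incl D))
  (fun A => fcPsi e A) _).
move=> A B h /=; toK; rewrite !vcomp1l !vcomp1r; exact: Psi_mod.
Defined.

Definition kPhi : Modification
  (cd_id JU) (cd_comp (cd_post JU kcounit) (cd_pre kunit JU)).
Proof.
refine (@Build_Modification _ _ _ _ (cd_id JU) (cd_comp (cd_post JU kcounit) (cd_pre kunit JU))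
  (fun C => J_unit D (fcPhi e C)) _).
move=> C X h /=; toK; rewrite !J2_id !vcomp1l !vcomp1r; exact: J_Phi_mod.
Defined.

Definition kleisli_adjunction : ColaxAdjunction (Kleisli_incl D) JU.
Proof.
refine (@Build_ColaxAdjunction (Kleisli D) (PsAlg D) (Kleisli_incl D) JU
  kunit kcounit kPsi kPhi _ _).
- move=> A /=; toK; rewrite !J2_id !vcomp1l !vcomp1r.
  exact: J_unit_triangle.
- move=> C /=; toK; rewrite !vcomp1l !vcomp1r.
  exact: counit_triangle.
Defined.

End Kleisli.

Theorem corollary4p17 (K : TwoCat) (D : LeftKanPseudomonad K) :
  (exists B : Biadjunction (free D) (forgetful D), is_free_forgetful B)
  /\ forall B : Biadjunction (free D) (forgetful D), is_free_forgetful B ->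
     exists A : ColaxAdjunction (Kleisli_incl D) (pf_comp (J D) (forgetful D)),
       is_induced_by B A.
Proof.
split.
  exists (free_biadjunction (e := can_counit D) (@can_eps2_iso K D) (@can_Psi_iso K D)).
  by [].
move=> B HB; have [e eE] := free_counit_of HB (@biadj_Phi _ _ _ _ B).
exists (kleisli_adjunction e); split; first exact: eE.
by move=> a; rewrite HB.
Qed.
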